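(* Let $c\in\mathbb{R}$ with $c^2\neq 1$, let $\hat U$ be a periodic (modulo $2\pi$) standing wave of the sine-Gordon equation with fundamental period $T$, let $\theta\in[0,2\pi)$, and let $\zeta_0\in\mathbb{R}$ be a simple characteristic value of the pencil $\mathcal{L}_{SG}$ for the Floquet exponent $\theta$ (all as in the context). Let $\mu(\zeta)$ be the single analytic eigenvalue branch of $\mathcal{L}_{SG}(\zeta)$ vanishing at $\zeta_0$, and let $D_{Hill}(\zeta):=\operatorname{tr}(\mathbb{H}(T;\zeta))-2$, with $D_{Hill}'$ its derivative in $\zeta$. Then $\zeta_0\neq0$, $D_{Hill}'(\zeta_0)\neq 0$, $$\mu'(\zeta_{0}) = \frac{2\zeta_{0}}{(c^{2} - 1)^{2}} +\frac{4c\zeta_{0}T}{(c^{2} - 1)^{3}}\, \frac{\sin\left(\frac{c\zeta_{0} T}{c^{2}-1} + \theta\right)}{D_{Hill}'(\zeta_{0})},$$ and hence the Krein signature of $\zeta_0$ is $$\kappa(\zeta_{0}) = \operatorname{sign}\left(\frac{2\zeta_{0}}{(c^{2} - 1)^{2}} +\frac{4c\zeta_{0}T}{(c^{2} - 1)^{3}}\, \frac{\sin\left(\frac{c\zeta_{0} T}{c^{2}-1} + \theta\right)}{D_{Hill}'(\zeta_{0})}\right).$$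
   Context: Standing wave: $\hat U:\mathbb{R}\to\mathbb{R}$ is a non-constant solution of $(c^2-1)\hat U_{zz}+\sin(\hat U)=0$ that is periodic modulo $2\pi$ with fundamental period $T>0$, i.e. $\hat U(z+T)=\hat U(z)\ (\mathrm{mod}\ 2\pi)$ for all $z$. In particular $\cos(\hat U)$ is $T$-periodic. Pencil: for $\zeta\in\mathbb{C}$, $$\mathcal{L}_{SG}(\zeta) := -\frac{\zeta^2}{c^2-1}\mathbb{I} - \frac{2ic\zeta}{c^2-1}\partial_{z}+\left(\partial_{z}^2 + \frac{\cos(\hat{U})}{c^2-1}\right).$$ For a Floquet exponent $\theta\in[0,2\pi)$ it acts in $L^2([0,T])$ on the domain of complex-valued $p\in C^2([0,T])$ satisfying the quasi-periodicity condition $p(z)=e^{i\theta}p(z+T)$, that is, $p(T)=e^{-i\theta}p(0)$ and $p'(T)=e^{-i\theta}p'(0)$. For real $\zeta$ this operator is self-adjoint with compact resolvent. Characteristic values: $\zeta_0$ is a characteristic value (for the Floquet exponent $\theta$) if $\mathcal{L}_{SG}(\zeta_0)p=0$ for some $p\ne0$ in the domain. Its geometric multiplicity is $k=\dim\ker\mathcal{L}_{SG}(\zeta_0)$. For real $\zeta_0$ there are exactly $k$ analytic eigenvalue branches $\mu_1(\zeta),\dots,\mu_k(\zeta)$ vanishing at $\zeta_0$, where an eigenvalue branch is an analytic $\mu(\zeta)$ satisfying $\mathcal{L}_{SG}(\zeta)u(\zeta)=\mu(\zeta)u(\zeta)$ near $\zeta_0$ with $u(\zeta)\neq0$ analytic.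 The algebraic multiplicity of $\zeta_0$ is the sum of the orders of vanishing of these branches at $\zeta_0$. A characteristic value is simple if its geometric and algebraic multiplicities are both $1$. The (graphical) Krein signature of a simple real characteristic value $\zeta_0$ with eigenvalue branch $\mu$ is $\kappa(\zeta_0)=\operatorname{sign}(\mu'(\zeta_0))$. Hill's equation and monodromy matrix: let $q_1(z;\zeta),q_2(z;\zeta)$ be the solutions of $$q'' + \left(\frac{\zeta^{2}}{(c^2-1)^{2}} + \frac{\cos(\hat{U})}{c^2-1}\right)q = 0$$ with $q_1(0;\zeta)=1,\ q_1'(0;\zeta)=0,\ q_2(0;\zeta)=0,\ q_2'(0;\zeta)=1$, and set $\mathbb{H}(z;\zeta)=\begin{pmatrix} q_1(z;\zeta)&q_2(z;\zeta)\\ q_1'(z;\zeta)&q_2'(z;\zeta)\end{pmatrix}$. The monodromy matrix is $\mathbb{H}(T;\zeta)$. *)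

(* Defs.v *)
From Stdlib Require Export Reals List.
From Coquelicot Require Export Coquelicot.
Open Scope R_scope.

Definition periodic_mod_2pi (U : R -> R) (S : R) : Prop :=
  forall z : R, exists k : Z, U (z + S) = U z + 2 * PI * IZR k.

(* [ex_derive U z] is listed separately because [Derive] is total:
   differentiability of [Derive U] does not entail that of [U]. *)
Definition standing_wave (c : R) (U : R -> R) (T : R) : Prop :=
  (forall z : R, ex_derive U z /\ ex_derive (Derive U) z /\
     (c ^ 2 - 1) * Derive_n U 2 z + sin (U z) = 0) /\
  (exists z1 z2 : R, U z1 <> U z2) /\
  0 < T /\ periodic_mod_2pi U T /\
  (forall S : R, 0 < S -> periodic_mod_2pi U S -> T <= S).

Definition on_interval (T z : R) : Prop := 0 <= z <= T.

(* Neighbourhood filter of [z] in the closed interval; limits and derivatives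
   along it are one-sided at the endpoints. *)
Definition locally_in (T z : R) : (R -> Prop) -> Prop :=
  within (on_interval T) (locally z).

Definition continuous_in (T : R) (f : R -> C) : Prop :=
  forall z : R, on_interval T z ->
    filterlim f (locally_in T z) (locally (f z)).

Definition derivative_in (T : R) (f f' : R -> C) : Prop :=
  forall z : R, on_interval T z ->
    @filterdiff R_AbsRing R_NormedModule C_R_NormedModule f (locally_in T z)
      (fun h : R => @scal R_AbsRing C_R_NormedModule h (f' z)).

(* Only the values on [0,T] are meaningful; equality of two such functions
   always means pointwise equality on [0,T]. *)
Record C2 (T : R) : Type := mkC2 {
  c2_val :> R -> C;
  c2_d1 : R -> C;
  c2_d2 : R -> C;
  c2_val_d1 : derivative_in T c2_val c2_d1;
  c2_d1_d2 : derivative_in T c2_d1 c2_d2;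
  c2_d2_cont : continuous_in T c2_d2
}.
Arguments c2_val {T}.
Arguments c2_d1 {T}.
Arguments c2_d2 {T}.

Definition nonzero_in {T : R} (p : C2 T) : Prop :=
  exists z : R, on_interval T z /\ p z <> RtoC 0.

Definition exp_i (t : R) : C := (cos t, sin t).

Definition quasi_periodic {T : R} (theta : R) (p : C2 T) : Prop :=
  p T = Cmult (exp_i (- theta)) (p 0) /\
  c2_d1 p T = Cmult (exp_i (- theta)) (c2_d1 p 0).

Definition L_SG (c : R) (U : R -> R) {T : R} (zeta : C) (p : C2 T) (z : R) : C :=
  (- (zeta * zeta / RtoC (c ^ 2 - 1)) * p z
   - RtoC 2 * Ci * RtoC c * zeta / RtoC (c ^ 2 - 1) * c2_d1 p z
   + (c2_d2 p z + RtoC (cos (U z) / (c ^ 2 - 1)) * p z))%C.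

Definition in_kernel (c : R) (U : R -> R) (T theta : R) (zeta : C) (p : C2 T) : Prop :=
  quasi_periodic theta p /\
  (forall z : R, on_interval T z -> L_SG c U zeta p z = RtoC 0).

Definition characteristic_value (c : R) (U : R -> R) (T theta : R) (zeta : C) : Prop :=
  exists p : C2 T, in_kernel c U T theta zeta p /\ nonzero_in p.

(* Families of size [k] are indexed by [1, ..., k]; for [k = 0] the sum is empty. *)
Definition lin_comb {T : R} (k : nat) (a : nat -> C) (p : nat -> C2 T) (z : R) : C :=
  @sum_n_m C_AbelianMonoid (fun j => Cmult (a j) (p j z)) 1 k.

Definition lin_indep {T : R} (k : nat) (p : nat -> C2 T) : Prop :=
  forall a : nat -> C,
    (forall z : R, on_interval T z -> lin_comb k a p z = RtoC 0) ->
    forall j : nat, (1 <= j <= k)%nat -> a j = RtoC 0.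

Definition geometric_multiplicity (c : R) (U : R -> R) (T theta : R) (zeta : C)
    (k : nat) : Prop :=
  exists p : nat -> C2 T,
    (forall j : nat, (1 <= j <= k)%nat -> in_kernel c U T theta zeta (p j)) /\
    lin_indep k p /\
    (forall q : C2 T, in_kernel c U T theta zeta q ->
       exists a : nat -> C,
         forall z : R, on_interval T z -> q z = lin_comb k a p z).

Definition analytic_at (f : R -> R) (x0 : R) : Prop :=
  exists (a : nat -> R) (eps : posreal),
    forall x : R, Rabs (x - x0) < eps -> is_pseries a (x - x0) (f x).

(* Analyticity as a map into L^2([0,T]): power series expansion convergent in
   the L^2 norm.  For the eigenfunction branches used below the coefficients
   automatically lie in the domain of the pencil, by elliptic regularity, so
   asking for continuous coefficients is no restriction and makes all the
   integrals Riemann integrals. *)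
Definition L2_analytic_at {T : R} (u : R -> C2 T) (x0 : R) : Prop :=
  exists (a : nat -> R -> C) (eps : posreal),
    (forall n : nat, continuous_in T (a n)) /\
    forall x : R, Rabs (x - x0) < eps ->
      is_lim_seq
        (fun N : nat => RInt (fun z : R =>
           Cmod (Cminus (u x z)
             (@sum_n C_AbelianMonoid
                (fun n => Cmult (RtoC ((x - x0) ^ n)) (a n z)) N)) ^ 2) 0 T)
        0.

(* The parameter is real, where the pencil is self-adjoint; hence eigenvalues
   are real and branches are real-analytic. *)
Definition eigenpair_branch (c : R) (U : R -> R) (T theta zeta0 : R)
    (mu : R -> R) (u : R -> C2 T) : Prop :=
  analytic_at mu zeta0 /\ L2_analytic_at u zeta0 /\
  locally zeta0 (fun zeta : R =>
    quasi_periodic theta (u zeta) /\ nonzero_in (u zeta) /\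
    forall z : R, on_interval T z ->
      L_SG c U (RtoC zeta) (u zeta) z = Cmult (RtoC (mu zeta)) (u zeta z)).

Definition eigenvalue_branch (c : R) (U : R -> R) (T theta zeta0 : R)
    (mu : R -> R) : Prop :=
  exists u : R -> C2 T, eigenpair_branch c U T theta zeta0 mu u.

Definition order_of_vanishing (f : R -> R) (x0 : R) (n : nat) : Prop :=
  (forall i : nat, (i < n)%nat -> Derive_n f i x0 = 0) /\ Derive_n f n x0 <> 0.

(* The [k] branches through [zeta0] are counted with multiplicity (two of them
   may coincide as functions); linear independence of the eigenfunctions at
   [zeta0] ensures that each one is listed exactly as often as it occurs. *)
Definition algebraic_multiplicity (c : R) (U : R -> R) (T theta zeta0 : R)
    (m : nat) : Prop :=
  exists (k : nat) (mu : nat -> R -> R) (u : nat -> R -> C2 T) (ord : nat -> nat),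
    geometric_multiplicity c U T theta (RtoC zeta0) k /\
    (forall j : nat, (1 <= j <= k)%nat ->
       eigenpair_branch c U T theta zeta0 (mu j) (u j) /\
       mu j zeta0 = 0 /\
       order_of_vanishing (mu j) zeta0 (ord j)) /\
    lin_indep k (fun j => u j zeta0) /\
    m = list_sum (map ord (seq 1 k)).

Definition simple_characteristic_value (c : R) (U : R -> R) (T theta zeta0 : R) : Prop :=
  characteristic_value c U T theta (RtoC zeta0) /\
  geometric_multiplicity c U T theta (RtoC zeta0) 1 /\
  algebraic_multiplicity c U T theta zeta0 1.

(* Krein signature of a simple real characteristic value [zeta0], computed from
   the eigenvalue branch [mu] vanishing there. *)
Definition krein_signature (mu : R -> R) (zeta0 : R) : R := sign (Derive mu zeta0).

Definition hill_solution (c : R) (U : R -> R) (zeta : R) (q : R -> R) : Prop :=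
  forall z : R, ex_derive q z /\ ex_derive (Derive q) z /\
    Derive_n q 2 z
      + (zeta ^ 2 / (c ^ 2 - 1) ^ 2 + cos (U z) / (c ^ 2 - 1)) * q z = 0.

(* Argument order [q z zeta]. *)
Definition hill_fundamental (c : R) (U : R -> R) (q1 q2 : R -> R -> R) : Prop :=
  forall zeta : R,
    hill_solution c U zeta (fun z => q1 z zeta) /\
    q1 0 zeta = 1 /\ Derive (fun z => q1 z zeta) 0 = 0 /\
    hill_solution c U zeta (fun z => q2 z zeta) /\
    q2 0 zeta = 0 /\ Derive (fun z => q2 z zeta) 0 = 1.

Definition H_matrix (q1 q2 : R -> R -> R) (z zeta : R) : @matrix R 2 2 :=
  mk_matrix 2 2 (fun i j =>
    match i, j with
    | O, O => q1 z zeta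
    | O, _ => q2 z zeta
    | _, O => Derive (fun y => q1 y zeta) z
    | _, _ => Derive (fun y => q2 y zeta) z
    end).

Definition trace {n : nat} (M : @matrix R n n) : R :=
  sum_n_m (fun i => coeff_mat 0 M (i - 1) (i - 1)) 1 n.

Definition D_Hill (q1 q2 : R -> R -> R) (T zeta : R) : R :=
  trace (H_matrix q1 q2 T zeta) - 2.

(* Main.v *)
Require Import Defs.
From Stdlib Require Import Lra Lia Psatz Classical.

(** Substituting [p = exp (i k z) w] with [k = c zeta / (c^2 - 1)] turns
    [L_SG zeta p = mu p] into Hill's equation [w'' + (lam + Q) w = 0] with
    [lam = zeta^2 / (c^2 - 1)^2 - mu] and Floquet multiplier [exp (- i (k T + theta))].
    Hence [Delta (lam) = 2 cos (k T + theta)] along every eigenvalue branch, where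
    [Delta] is the trace of the monodromy matrix; differentiating this relation at
    [zeta0], together with [D_Hill zeta = Delta (zeta^2 / (c^2 - 1)^2) - 2], gives the
    formula.  As [Delta] is needed for [lam < 0] too when [zeta0 = 0], it is
    replaced by a first-order expansion, valid for every solution that happens to exist
    near [lam0], whose coefficient is the integral of a quadratic form in the basis
    solutions.  That form is semidefinite in the stability bands, so its integral only
    vanishes when the monodromy matrix is scalar, that is, when the kernel is
    two-dimensional.  If [zeta0 = 0], the periodic solution [U'] forces
    [sin theta = 0], so the branches vanish to order at least two at [0]. *)

(** * Perturbation of solutions of Hill's equation *)

(** Eigenfunctions live on [[0,T]] only and are later extended by constants. The extension is
    continuous on the whole line but satisfies the equation only inside, which is all that mean
    value arguments and Riemann integrals use. The derivative [w'] is carried as a function of its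
    own for the same reason. *)
Definition hill_on (Q : R -> R) (lam T : R) (w w' : R -> R) : Prop :=
  (forall z, continuous w z /\ continuous w' z) /\
  (forall z, 0 < z < T ->
     is_derive w z (w' z) /\ is_derive w' z (- (lam + Q z) * w z)).

Definition hill_basis (Q : R -> R) (lam T : R) (y1 y1' y2 y2' : R -> R) : Prop :=
  hill_on Q lam T y1 y1' /\ hill_on Q lam T y2 y2' /\
  y1 0 = 1 /\ y1' 0 = 0 /\ y2 0 = 0 /\ y2' 0 = 1.

Lemma cont_mult (f g : R -> R) (z : R) :
  continuous f z -> continuous g z -> continuous (fun x => f x * g x) z.
Proof. intros Hf Hg; exact (continuous_mult f g z Hf Hg). Qed.

Lemma cont_plus (f g : R -> R) (z : R) :
  continuous f z -> continuous g z -> continuous (fun x => f x + g x) z.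
Proof. intros Hf Hg; exact (continuous_plus f g z Hf Hg). Qed.

Lemma cont_minus (f g : R -> R) (z : R) :
  continuous f z -> continuous g z -> continuous (fun x => f x - g x) z.
Proof. intros Hf Hg; exact (continuous_minus f g z Hf Hg). Qed.

Ltac cont :=
  match goal with
  | |- continuous (fun x => @?f x - @?g x) _ => apply (cont_minus f g); cont
  | |- continuous (fun x => @?f x + @?g x) _ => apply (cont_plus f g); cont
  | |- continuous (fun x => @?f x * @?g x) _ => apply (cont_mult f g); cont
  | |- continuous (fun _ => ?a) _ => apply continuous_const
  | _ => try assumption
  end.

Ltac derive_with H :=
  match type of H with
  | is_derive ?f ?x ?l =>
      replace (Derive (fun t => f t) x) with l
        by (symmetry; exact (is_derive_unique f x l H))
  end.

Lemma mean_value_on (T : R) (f df : R -> R) (z : R) :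
  (forall x, continuous f x) ->
  (forall x, 0 < x < T -> is_derive f x (df x)) ->
  0 <= z <= T ->
  exists x, 0 <= x <= T /\ f z - f 0 = df x * z.
Proof.
intros Hc Hd Hz.
destruct (MVT_gen f 0 z df) as [x [Hx E]].
- intros x; rewrite Rmin_left, Rmax_right by lra; intros Hx; apply Hd; lra.
- intros x _; apply continuity_pt_filterlim, Hc.
- rewrite Rmin_left, Rmax_right in Hx by lra.
  exists x; split; [lra|]. rewrite E; ring.
Qed.

Lemma bounded_increment (T : R) (f df : R -> R) (B z : R) :
  (forall x, continuous f x) ->
  (forall x, 0 < x < T -> is_derive f x (df x)) ->
  (forall x, 0 <= x <= T -> Rabs (df x) <= B) ->
  0 <= z <= T -> Rabs (f z - f 0) <= B * T.
Proof.
intros Hc Hd HB Hz.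
destruct (mean_value_on T f df z Hc Hd Hz) as [x [Hx ->]].
rewrite Rabs_mult, (Rabs_pos_eq z) by lra.
specialize (HB x Hx). pose proof (Rabs_pos (df x)). nra.
Qed.

Lemma continuous_bounded (T : R) (f : R -> R) :
  0 <= T -> (forall x, continuous f x) ->
  exists B, forall x, 0 <= x <= T -> Rabs (f x) <= B.
Proof.
intros HT Hc.
destruct (continuity_ab_maj (fun x => Rabs (f x)) 0 T HT) as [m [Hm _]].
- intros x _; apply continuity_pt_filterlim.
  apply (continuous_comp f Rabs); [apply Hc | apply continuous_Rabs].
- exists (Rabs (f m)); exact Hm.
Qed.

(** Hill's equation has no first-order term, so the Wronskian has zero derivative and its increment
    is bounded by [0 * T]. *)
Lemma wronskian_basis (Q : R -> R) (lam T : R) (y1 y1' y2 y2' : R -> R) (z : R) :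
  hill_basis Q lam T y1 y1' y2 y2' -> 0 <= z <= T ->
  y1 z * y2' z - y1' z * y2 z = 1.
Proof.
intros [[C1 D1] [[C2 D2] [I1 [I1' [I2 I2']]]]] Hz.
assert (H : Rabs ((y1 z * y2' z - y1' z * y2 z) - (y1 0 * y2' 0 - y1' 0 * y2 0)) <= 0 * T).
{ apply (bounded_increment T (fun x => y1 x * y2' x - y1' x * y2 x) (fun _ => 0)); [ | | | lra].
  - intros s; destruct (C1 s), (C2 s); cont.
  - intros s Hs; destruct (D1 s Hs) as [a1 a2], (D2 s Hs) as [b1 b2].
    auto_derive.
    + repeat split; eexists; eassumption.
    + derive_with a1; derive_with a2; derive_with b1; derive_with b2; ring.
  - intros s _; rewrite Rabs_R0; lra. }
rewrite I1, I1', I2, I2' in H.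
pose proof (Rabs_pos (y1 z * y2' z - y1' z * y2 z - (1 * 1 - 0 * 0))).
assert (E : Rabs (y1 z * y2' z - y1' z * y2 z - (1 * 1 - 0 * 0)) = 0) by lra.
destruct (Req_dec (y1 z * y2' z - y1' z * y2 z - (1 * 1 - 0 * 0)) 0) as [e|e]; [lra|].
apply Rabs_no_R0 in e; lra.
Qed.

(* Gronwall for the coordinates [a1, a2] of a solution at parameter [lam0 + d]
   with respect to the basis [y1, y2] at parameter [lam0]. *)
Lemma coordinates_bound (T Y d : R) (y1 y2 a1 a2 : R -> R) (z : R) :
  Rabs d <= 1 ->
  (forall x, 0 <= x <= T -> Rabs (y1 x) <= Y /\ Rabs (y2 x) <= Y) ->
  (forall x, continuous a1 x /\ continuous a2 x) ->
  (forall x, 0 < x < T ->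
     is_derive a1 x (d * y2 x * (a1 x * y1 x + a2 x * y2 x)) /\
     is_derive a2 x (- d * y1 x * (a1 x * y1 x + a2 x * y2 x))) ->
  0 <= z <= T ->
  a1 z ^ 2 + a2 z ^ 2 <= (a1 0 ^ 2 + a2 0 ^ 2) * exp (4 * Y ^ 2 * T).
Proof.
intros Hd HY Ha HD Hz.
set (k := 4 * Y ^ 2).
(* [dE] is the derivative of [a1^2 + a2^2]. Once [dE <= k * (a1^2 + a2^2)] is known, the weighted
   energy [F] has nonpositive derivative. *)
set (F := fun x => (a1 x * a1 x + a2 x * a2 x) * exp (- k * x)).
set (dE := fun x => 2 * d * (a1 x * y2 x - a2 x * y1 x) * (a1 x * y1 x + a2 x * y2 x)).
destruct (mean_value_on T F
  (fun x => (dE x - k * (a1 x * a1 x + a2 x * a2 x)) * exp (- k * x)) z) as [x [Hx E]].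
- intros x; unfold F; destruct (Ha x); cont.
  apply (ex_derive_continuous (fun t => exp (- k * t))); auto_derive; auto.
- intros x Hx; destruct (HD x Hx) as [h1 h2]; unfold F.
  auto_derive.
  + repeat split; eexists; eassumption.
  + derive_with h1; derive_with h2.
    unfold dE; ring.
- exact Hz.
- destruct (HY x Hx) as [Y1 Y2].
  assert (HdE : dE x <= k * (a1 x * a1 x + a2 x * a2 x)).
  { unfold dE, k.
    (* Here [dE = 2 * d * u * v] and [u^2 + v^2] factors as a product of squared norms, so
       [Rabs d <= 1] and the arithmetic-geometric inequality suffice. *)
    set (u := a1 x * y2 x - a2 x * y1 x). set (v := a1 x * y1 x + a2 x * y2 x).
    assert (Yy : y1 x * y1 x <= Y ^ 2 /\ y2 x * y2 x <= Y ^ 2).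
    { split; replace (Y ^ 2) with (Y * Y) by ring; apply Rsqr_le_abs_1;
      rewrite (Rabs_pos_eq Y); auto; apply Rle_trans with (2 := Y1), Rabs_pos. }
    assert (Euv : u * u + v * v = (a1 x * a1 x + a2 x * a2 x) * (y1 x * y1 x + y2 x * y2 x))
      by (unfold u, v; ring).
    assert (B : 2 * d * u * v <= u * u + v * v).
    { apply Rabs_le_between in Hd.
      pose proof (Rmult_le_pos (1 + d) ((u - v) ^ 2) ltac:(lra) (pow2_ge_0 _)).
      pose proof (Rmult_le_pos (1 - d) ((u + v) ^ 2) ltac:(lra) (pow2_ge_0 _)).
      nra. }
    nra. }
  assert (HE : F z <= F 0).
  { pose proof (exp_pos (- k * x)).
    assert ((dE x - k * (a1 x * a1 x + a2 x * a2 x)) * exp (- k * x) <= 0) by nra.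
    nra. }
  unfold F in HE. rewrite Rmult_0_r, exp_0 in HE.
  assert (K0 : 0 <= k) by (unfold k; nra).
  assert (H1 : a1 z ^ 2 + a2 z ^ 2 <= (a1 0 ^ 2 + a2 0 ^ 2) * exp (k * z)).
  { replace (a1 z ^ 2 + a2 z ^ 2)
      with ((a1 z * a1 z + a2 z * a2 z) * exp (- k * z) * exp (k * z)).
    - apply Rmult_le_compat_r; [left; apply exp_pos | lra].
    - rewrite Rmult_assoc, <- exp_plus.
      replace (- k * z + k * z) with 0 by ring. rewrite exp_0; ring. }
  apply Rle_trans with (1 := H1), Rmult_le_compat_l; [nra|].
  destruct (Rle_lt_or_eq_dec (k * z) (k * T)) as [h|h]; [nra | left; apply exp_increasing, h | rewrite h; lra].
Qed.

Lemma is_derive_primitive (f : R -> R) (z : R) :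
  (forall x, continuous f x) -> is_derive (fun x => RInt f 0 x) z (f z).
Proof.
intros Hf; apply is_derive_RInt with (a := 0); [|apply Hf].
apply filter_forall; intros x; apply RInt_correct, ex_RInt_continuous; auto.
Qed.

Lemma continuous_primitive (f : R -> R) (z : R) :
  (forall x, continuous f x) -> continuous (fun x => RInt f 0 x) z.
Proof.
intros Hf; apply (ex_derive_continuous (fun x => RInt f 0 x)).
eexists; apply is_derive_primitive, Hf.
Qed.

Definition overlap (T : R) (f g : R -> R) : R := RInt (fun s => f s * g s) 0 T.

(* Variation of constants: [A1, A2] are the coordinates at [T] of the solution
   at parameter [lam], with respect to the basis at parameter [lam0]. *)
Lemma solution_perturbation (Q : R -> R) (lam0 T : R) (y1 y1' y2 y2' : R -> R) :
  0 < T -> hill_basis Q lam0 T y1 y1' y2 y2' ->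
  exists K, 0 <= K /\
    forall (lam : R) (w w' : R -> R),
      hill_on Q lam T w w' -> Rabs (lam - lam0) <= 1 ->
      (forall z, 0 <= z <= T -> Rabs (w z) <= K * (Rabs (w 0) + Rabs (w' 0))) /\
      exists A1 A2,
        w T = A1 * y1 T + A2 * y2 T /\
        w' T = A1 * y1' T + A2 * y2' T /\
        Rabs (A1 - (w 0 + (lam - lam0) *
          (w 0 * overlap T y1 y2 + w' 0 * overlap T y2 y2)))
          <= K * (lam - lam0) ^ 2 * (Rabs (w 0) + Rabs (w' 0)) /\
        Rabs (A2 - (w' 0 - (lam - lam0) *
          (w 0 * overlap T y1 y1 + w' 0 * overlap T y1 y2)))
          <= K * (lam - lam0) ^ 2 * (Rabs (w 0) + Rabs (w' 0)).
Proof.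
intros HT Hy; pose proof Hy as [[C1 D1] [[C2 D2] [I1 [I1' [I2 I2']]]]].
destruct (continuous_bounded T y1) as [Y1 HY1]; [lra | apply C1 |].
destruct (continuous_bounded T y2) as [Y2 HY2]; [lra | apply C2 |].
set (Y := Y1 + Y2).
assert (HY : forall x, 0 <= x <= T -> Rabs (y1 x) <= Y /\ Rabs (y2 x) <= Y).
{ intros x Hx; specialize (HY1 x Hx); specialize (HY2 x Hx); unfold Y.
  pose proof (Rabs_pos (y1 x)); pose proof (Rabs_pos (y2 x)); lra. }
assert (Y0 : 0 <= Y).
{ destruct (HY 0) as [h _]; [lra|]; apply Rle_trans with (2 := h), Rabs_pos. }
set (G := exp (4 * Y ^ 2 * T)).
assert (G1 : 1 <= G).
{ unfold G; rewrite <- exp_0.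
  destruct (Rle_lt_or_eq_dec 0 (4 * Y ^ 2 * T)) as [h|h].
  - pose proof (pow2_ge_0 Y); apply Rmult_le_pos; lra.
  - left; apply exp_increasing, h.
  - rewrite <- h; lra. }
assert (P1 : 0 <= 2 * Y * G) by (apply Rmult_le_pos; lra).
assert (P2 : 0 <= 2 * Y ^ 2 * G * T).
{ pose proof (pow2_ge_0 Y); repeat apply Rmult_le_pos; lra. }
assert (P3 : 0 <= 2 * Y ^ 2 * (2 * Y ^ 2 * G * T) * T).
{ pose proof (pow2_ge_0 Y); repeat apply Rmult_le_pos; lra. }
(* The first summand bounds [w] itself, through [Rabs (a_i x) <= S * G]. The second one bounds the
   quadratic error, obtained by passing twice through the coordinate equations. *)
exists (2 * Y * G + 2 * Y ^ 2 * (2 * Y ^ 2 * G * T) * T); split; [lra|].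
intros lam w w' [Cw Dw] Hd.
set (d := lam - lam0) in *.
(* Coordinates of [(w, w')] in the basis by Cramer's rule, the Wronskian being [1]. *)
set (a1 := fun x => w x * y2' x - w' x * y2 x).
set (a2 := fun x => y1 x * w' x - y1' x * w x).
assert (a10 : a1 0 = w 0) by (unfold a1; rewrite I2, I2'; ring).
assert (a20 : a2 0 = w' 0) by (unfold a2; rewrite I1, I1'; ring).
set (S := Rabs (w 0) + Rabs (w' 0)).
assert (HS : Rabs (a1 0) + Rabs (a2 0) = S) by (rewrite a10, a20; reflexivity).
assert (S0 : 0 <= S) by (rewrite <- HS; pose proof (Rabs_pos (a1 0)); pose proof (Rabs_pos (a2 0)); lra).
assert (Ew : forall x, 0 <= x <= T -> w x = a1 x * y1 x + a2 x * y2 x).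
{ intros x Hx; pose proof (wronskian_basis _ _ _ _ _ _ _ x Hy Hx) as W.
  unfold a1, a2.
  replace (w x) with (w x * (y1 x * y2' x - y1' x * y2 x)) at 1 by (rewrite W; ring).
  ring. }
assert (Ew' : forall x, 0 <= x <= T -> w' x = a1 x * y1' x + a2 x * y2' x).
{ intros x Hx; pose proof (wronskian_basis _ _ _ _ _ _ _ x Hy Hx) as W.
  unfold a1, a2.
  replace (w' x) with (w' x * (y1 x * y2' x - y1' x * y2 x)) at 1 by (rewrite W; ring).
  ring. }
assert (Ca : forall x, continuous a1 x /\ continuous a2 x).
{ intros x; destruct (C1 x), (C2 x), (Cw x); unfold a1, a2; split; cont. }
assert (Da : forall x, 0 < x < T ->
     is_derive a1 x (d * y2 x * (a1 x * y1 x + a2 x * y2 x)) /\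
     is_derive a2 x (- d * y1 x * (a1 x * y1 x + a2 x * y2 x))).
{ intros x Hx; rewrite <- Ew by lra.
  destruct (D1 x Hx) as [e1 e2], (D2 x Hx) as [f1 f2], (Dw x Hx) as [g1 g2].
  unfold a1, a2; split; auto_derive.
  - repeat split; eexists; eassumption.
  - derive_with f1; derive_with f2; derive_with g1; derive_with g2; unfold d; ring.
  - repeat split; eexists; eassumption.
  - derive_with e1; derive_with e2; derive_with g1; derive_with g2; unfold d; ring. }
assert (Ba : forall x, 0 <= x <= T -> Rabs (a1 x) <= S * G /\ Rabs (a2 x) <= S * G).
{ intros x Hx.
  pose proof (coordinates_bound T Y d y1 y2 a1 a2 x Hd HY Ca Da Hx) as B; fold G in B.
  assert (B0 : a1 0 ^ 2 + a2 0 ^ 2 <= S ^ 2).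
  { rewrite <- (pow2_abs (a1 0)), <- (pow2_abs (a2 0)), <- HS.
    pose proof (Rmult_le_pos _ _ (Rabs_pos (a1 0)) (Rabs_pos (a2 0))). nra. }
  assert (B1 : a1 x ^ 2 + a2 x ^ 2 <= (S * G) ^ 2).
  { apply Rle_trans with (1 := B).
    replace ((S * G) ^ 2) with (S ^ 2 * (G * G)) by ring.
    apply Rmult_le_compat; [nra | lra | exact B0 | nra]. }
  assert (SG : 0 <= S * G) by (apply Rmult_le_pos; lra).
  split; rewrite <- (Rabs_pos_eq (S * G)) by exact SG; apply Rsqr_le_abs_0; unfold Rsqr; nra. }
(* Common bound for the right-hand sides of the coordinate equations, applied first to the
   coordinates and then to their increments. *)
assert (Bprod : forall f b x e, 0 <= x <= T -> 
   Rabs f <= Y -> 0 <= e -> Rabs (fst b) <= e -> Rabs (snd b) <= e ->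
   Rabs (d * f * (fst b * y1 x + snd b * y2 x)) <= Rabs d * (2 * Y ^ 2 * e)).
{ intros f [b1 b2] x e Hx Hf He Hb1 Hb2; simpl in *.
  destruct (HY x Hx) as [h1 h2].
  rewrite !Rabs_mult, Rmult_assoc; apply Rmult_le_compat_l; [apply Rabs_pos|].
  replace (2 * (Y * (Y * 1)) * e) with (Y * (e * Y + e * Y)) by ring.
  apply Rmult_le_compat; [apply Rabs_pos | apply Rabs_pos | exact Hf |].
  apply Rle_trans with (1 := Rabs_triang _ _); rewrite !Rabs_mult.
  apply Rplus_le_compat; apply Rmult_le_compat; auto using Rabs_pos. }
assert (SG : 0 <= S * G) by (apply Rmult_le_pos; lra).
(* First pass: the coordinates move by [O(d)] only. *)
assert (Bd : forall x, 0 <= x <= T ->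
   Rabs (a1 x - a1 0) <= Rabs d * S * (2 * Y ^ 2 * G * T) /\
   Rabs (a2 x - a2 0) <= Rabs d * S * (2 * Y ^ 2 * G * T)).
{ intros x Hx.
  replace (Rabs d * S * (2 * Y ^ 2 * G * T)) with (Rabs d * (2 * Y ^ 2 * (S * G)) * T) by ring.
  split.
  - apply (bounded_increment T a1 _ _ x (fun s => proj1 (Ca s)) (fun s Hs => proj1 (Da s Hs))); auto.
    intros s Hs; destruct (HY s Hs), (Ba s Hs).
    apply (Bprod (y2 s) (a1 s, a2 s)); auto.
  - apply (bounded_increment T a2 _ _ x (fun s => proj2 (Ca s)) (fun s Hs => proj2 (Da s Hs))); auto.
    intros s Hs; destruct (HY s Hs), (Ba s Hs).
    replace (- d * y1 s) with (d * - y1 s) by ring.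
    apply (Bprod (- y1 s) (a1 s, a2 s)); auto; rewrite Rabs_Ropp; auto. }
set (e := Rabs d * S * (2 * Y ^ 2 * G * T)) in *.
assert (e0 : 0 <= e) by (unfold e; apply Rmult_le_pos; auto; apply Rmult_le_pos; auto using Rabs_pos).
assert (Ce : Rabs d * (2 * Y ^ 2 * e) * T <=
   (2 * Y * G + 2 * Y ^ 2 * (2 * Y ^ 2 * G * T) * T) * d ^ 2 * S).
{ rewrite <- (pow2_abs d); unfold e.
  assert (0 <= (2 * Y * G) * (Rabs d ^ 2 * S)).
  { apply Rmult_le_pos; [lra|]; apply Rmult_le_pos; auto; apply pow2_ge_0. }
  nra. }
assert (Cy : forall f g : R -> R, (forall x, continuous f x) -> (forall x, continuous g x) ->
  forall x, continuous (fun s => f s * g s) x) by (intros; cont; auto).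
assert (Cy1 : forall x, continuous y1 x) by apply C1.
assert (Cy2 : forall x, continuous y2 x) by apply C2.
pose proof (fun x => is_derive_primitive (fun s => y1 s * y1 s) x (Cy _ _ Cy1 Cy1)) as J11.
pose proof (fun x => is_derive_primitive (fun s => y1 s * y2 s) x (Cy _ _ Cy1 Cy2)) as J12.
pose proof (fun x => is_derive_primitive (fun s => y2 s * y2 s) x (Cy _ _ Cy2 Cy2)) as J22.
split.
{ intros x Hx; rewrite Ew by exact Hx.
  destruct (HY x Hx), (Ba x Hx).
  apply Rle_trans with (1 := Rabs_triang _ _); rewrite !Rabs_mult.
  apply Rle_trans with (S * G * Y + S * G * Y).
  - apply Rplus_le_compat; apply Rmult_le_compat; auto using Rabs_pos.
  - pose proof (Rmult_le_pos _ _ P3 S0). nra. }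
exists (a1 T), (a2 T).
split; [apply Ew; lra|]; split; [apply Ew'; lra|].
rewrite <- a10, <- a20; unfold overlap.
split; apply Rle_trans with (2 := Ce).
(* Second pass: [g] is [a1] minus its first-order correction, so its derivative is [d * y2] times a
   combination of the increments [a_i x - a_i 0]. These are already [O(d)], whence an error
   [O(d^2)]. *)
- set (g := fun x => a1 x - d * (a1 0 * RInt (fun s => y1 s * y2 s) 0 x
    + a2 0 * RInt (fun s => y2 s * y2 s) 0 x)).
  replace (a1 T - _) with (g T - g 0)
    by (unfold g; rewrite !RInt_point; unfold zero; simpl; ring).
  apply (bounded_increment T g
    (fun x => d * y2 x * ((a1 x - a1 0) * y1 x + (a2 x - a2 0) * y2 x))); [| | |lra].
  + intros x; destruct (Ca x); unfold g; cont; apply continuous_primitive; auto.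
  + intros x Hx; destruct (Da x Hx) as [h1 h2]; unfold g.
    set (F := fun x => RInt (fun s => y1 s * y2 s) 0 x).
    set (F' := fun x => RInt (fun s => y2 s * y2 s) 0 x).
    pose proof (J12 x : is_derive F x _) as k1; pose proof (J22 x : is_derive F' x _) as k2.
    change (is_derive (fun x => a1 x - d * (a1 0 * F x + a2 0 * F' x)) x
      (d * y2 x * ((a1 x - a1 0) * y1 x + (a2 x - a2 0) * y2 x))).
    (* The primitives are made opaque, so that their derivatives are taken from [k1] and [k2]. *)
    clearbody F F'; auto_derive.
    * repeat split; eexists; eassumption.
    * derive_with h1; derive_with k1; derive_with k2; ring.
  + intros x Hx; destruct (HY x Hx), (Bd x Hx).
    apply (Bprod (y2 x) (a1 x - a1 0, a2 x - a2 0)); auto.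
- set (g := fun x => a2 x + d * (a1 0 * RInt (fun s => y1 s * y1 s) 0 x
    + a2 0 * RInt (fun s => y1 s * y2 s) 0 x)).
  replace (a2 T - _) with (g T - g 0)
    by (unfold g; rewrite !RInt_point; unfold zero; simpl; ring).
  apply (bounded_increment T g
    (fun x => d * - y1 x * ((a1 x - a1 0) * y1 x + (a2 x - a2 0) * y2 x))); [| | |lra].
  + intros x; destruct (Ca x); unfold g; cont; apply continuous_primitive; auto.
  + intros x Hx; destruct (Da x Hx) as [h1 h2]; unfold g.
    set (F := fun x => RInt (fun s => y1 s * y1 s) 0 x).
    set (F' := fun x => RInt (fun s => y1 s * y2 s) 0 x).
    pose proof (J11 x : is_derive F x _) as k1; pose proof (J12 x : is_derive F' x _) as k2.
    change (is_derive (fun x => a2 x + d * (a1 0 * F x + a2 0 * F' x)) x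
      (d * - y1 x * ((a1 x - a1 0) * y1 x + (a2 x - a2 0) * y2 x))).
    clearbody F F'; auto_derive.
    * repeat split; eexists; eassumption.
    * derive_with h2; derive_with k1; derive_with k2; ring.
  + intros x Hx; destruct (HY x Hx), (Bd x Hx).
    apply (Bprod (- y1 x) (a1 x - a1 0, a2 x - a2 0)); auto; rewrite Rabs_Ropp; auto.
Qed.

(** * The discriminant *)

Lemma RInt_pos_of_pos_at (f : R -> R) (T x : R) :
  (forall z, continuous f z) -> (forall z, 0 <= f z) ->
  0 < x < T -> 0 < f x -> 0 < RInt f 0 T.
Proof.
intros Cf Pf Hx Hf.
assert (L : locally x (fun z => 0 < f z)).
{ apply (Cf x), (open_gt 0), Hf. }
destruct L as [eps Heps].
set (b := Rmin T (x + eps / 2)).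
assert (Hb : x < b <= T /\ b <= x + eps / 2).
{ unfold b; destruct eps as [e He]; simpl.
  repeat split; [apply Rmin_glb_lt; lra | apply Rmin_l | apply Rmin_r]. }
assert (E : forall u v, ex_RInt f u v) by (intros; apply (ex_RInt_continuous (V := R_CompleteNormedModule)); auto).
rewrite <- (RInt_Chasles f 0 x T), <- (RInt_Chasles f x b T) by apply E.
assert (0 <= RInt f 0 x) by (apply RInt_ge_0; auto; lra).
assert (0 <= RInt f b T) by (apply RInt_ge_0; auto; lra).
assert (0 < RInt f x b).
{ apply RInt_gt_0; auto; [lra|]; intros z Hz; apply Heps.
  apply Rabs_lt_between'; destruct eps as [e He]; simpl in *; lra. }
unfold plus; simpl; lra.
Qed.

(** If [y2] vanished on [(0,T)], so would [y2'] at the midpoint, and the Wronskian there would be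
    [0] instead of [1]. *)
Lemma basis_snd_nonzero (Q : R -> R) (lam T : R) (y1 y1' y2 y2' : R -> R) :
  0 < T -> hill_basis Q lam T y1 y1' y2 y2' -> exists x, 0 < x < T /\ y2 x <> 0.
Proof.
intros HT Hy; apply NNPP; intros H.
assert (Z : forall x, 0 < x < T -> y2 x = 0).
{ intros x Hx; apply NNPP; intros Hn; apply H; exists x; auto. }
assert (D : is_derive y2 (T / 2) 0).
{ apply (is_derive_ext_loc (fun _ => 0)); [|exact (is_derive_const (K := R_AbsRing) (V := R_NormedModule) 0 (T / 2))].
  assert (HT2 : 0 < T / 2) by lra.
  exists (mkposreal _ HT2); intros x Hx; symmetry; apply Z.
  apply Rabs_lt_between' in Hx; simpl in Hx; lra. }
pose proof (wronskian_basis _ _ _ _ _ _ _ (T / 2) Hy ltac:(lra)) as W.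
destruct Hy as [_ [[_ D2] _]].
destruct (D2 (T / 2)) as [e _]; [lra|].
rewrite (Z (T / 2)) in W by lra.
rewrite <- (is_derive_unique _ _ _ e), (is_derive_unique _ _ _ D) in W; lra.
Qed.

(** The first-order coefficient in [lam] of the trace of the monodromy matrix, read off from the
    variation of constants formula. *)
Definition discriminant_slope (T : R) (y1 y1' y2 y2' : R -> R) : R :=
  - y2 T * overlap T y1 y1 + (y1 T - y2' T) * overlap T y1 y2
  + y1' T * overlap T y2 y2.

(* For [y1 T + y2' T] in [-2, 2] the slope is the integral of a semidefinite
   quadratic form in [(y1, y2)], so it can only vanish with the form. *)
Lemma discriminant_slope_zero (Q : R -> R) (lam T : R) (y1 y1' y2 y2' : R -> R) :
  0 < T -> hill_basis Q lam T y1 y1' y2 y2' ->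
  (y1 T + y2' T) ^ 2 <= 4 ->
  discriminant_slope T y1 y1' y2 y2' = 0 ->
  y2 T = 0 /\ y1' T = 0 /\ y2' T = y1 T.
Proof.
intros HT Hy Htr Hs.
pose proof (wronskian_basis _ _ _ _ _ _ _ T Hy ltac:(lra)) as W.
destruct (basis_snd_nonzero _ _ _ _ _ _ _ HT Hy) as [x2 [Hx2 Hn2]].
destruct Hy as [[C1 _] [[C2 _] [I1 [_ [I2 _]]]]].
assert (c1 : forall x, continuous y1 x) by apply C1.
assert (c2 : forall x, continuous y2 x) by apply C2.
assert (E : forall (f g : R -> R), (forall x, continuous f x) -> (forall x, continuous g x) ->
   ex_RInt (fun s => f s * g s) 0 T).
{ intros f g Hf Hg; apply (ex_RInt_continuous (V := R_CompleteNormedModule)).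
  intros z _; cont; auto. }
assert (J22 : 0 < overlap T y2 y2).
{ apply (RInt_pos_of_pos_at _ _ x2); auto.
  - intros z; cont; auto.
  - intros z; apply Rle_0_sqr.
  - exact (Rlt_0_sqr _ Hn2). }
set (m12 := y2 T) in *; set (m21 := y1' T) in *.
set (m11 := y1 T) in *; set (m22 := y2' T) in *.
(* By the Wronskian identity this discriminant of the form equals [(m11 + m22)^2 - 4]. *)
assert (Disc : (m11 - m22) ^ 2 + 4 * m12 * m21 <= 0) by nra.
assert (H12 : m12 = 0).
{ apply NNPP; intros Hn.
  (* Multiplying the form by [- m12] completes the square and makes it nonnegative. At [0], where
     [(y1, y2) = (1, 0)], it equals [m12^2], so its integral would be positive, whereas the
     vanishing slope makes it [0]. *)
  set (h := fun x => - m12 * (- m12 * (y1 x * y1 x) + (m11 - m22) * (y1 x * y2 x)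
     + m21 * (y2 x * y2 x))).
  assert (Ch : forall x, continuous h x) by (intros z; unfold h; cont; auto).
  assert (Ph : forall x, 0 <= h x).
  { intros z; unfold h.
    replace (- m12 * _) with ((m12 * y1 z - (m11 - m22) / 2 * y2 z) ^ 2
       + - ((m11 - m22) ^ 2 + 4 * m12 * m21) * (y2 z ^ 2 / 4)) by field.
    apply Rplus_le_le_0_compat; [apply pow2_ge_0|].
    apply Rmult_le_pos; [lra|]; pose proof (pow2_ge_0 (y2 z)); lra. }
  assert (Ih : RInt h 0 T = 0).
  { unfold h.
    pose proof (E _ _ c1 c1) as e11; pose proof (E _ _ c1 c2) as e12.
    pose proof (E _ _ c2 c2) as e22.
    transitivity (- m12 * discriminant_slope T y1 y1' y2 y2'); [|rewrite Hs; apply Rmult_0_r].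
    unfold discriminant_slope, overlap.
    apply is_RInt_unique.
    apply (is_RInt_scal (V := R_NormedModule) _ 0 T (- m12)).
    apply (is_RInt_plus (V := R_NormedModule)); [apply (is_RInt_plus (V := R_NormedModule))|];
    apply (is_RInt_scal (V := R_NormedModule)), (RInt_correct (V := R_CompleteNormedModule)); auto. }
  assert (h0 : 0 < h 0).
  { unfold h; rewrite I1, I2. 
    replace (- m12 * _) with (m12 * m12) by ring. exact (Rlt_0_sqr _ Hn). }
  assert (L : locally 0 (fun z => 0 < h z)) by (apply (Ch 0), (open_gt 0), h0).
  destruct L as [eps Heps].
  assert (Hm : 0 < Rmin T eps) by (apply Rmin_pos; [lra | apply eps]).
  pose proof (Rmin_l T eps); pose proof (Rmin_r T eps).
  assert (0 < RInt h 0 T); [|lra].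
  apply (RInt_pos_of_pos_at _ _ (Rmin T eps / 2)); auto; [lra|].
  apply Heps, Rabs_lt_between'; lra. }
assert (Hd : m22 = m11) by (rewrite H12 in Disc; nra).
repeat split; auto.
(* Only [m21] times the positive integral of [y2^2] is left of the slope. *)
unfold discriminant_slope in Hs; fold m11 m12 m21 m22 in Hs; rewrite H12, Hd in Hs.
destruct (Rmult_integral m21 (overlap T y2 y2)); [lra | auto | lra].
Qed.

(** * Expansion of the discriminant along Bloch solutions *)

(** Cramer's rule: the determinant times [a] or [b] is a combination of [u] and [v]. Hence a matrix
    that almost annihilates a nonzero vector has a small determinant. *)
Lemma det2_bound (p q r s a b u v : C) (e : R) :
  (p * a + q * b = u)%C -> (r * a + s * b = v)%C ->
  Cmod u <= e * (Cmod a + Cmod b) -> Cmod v <= e * (Cmod a + Cmod b) ->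
  0 < Cmod a + Cmod b ->
  Cmod (p * s - q * r)%C <= e * (Cmod p + Cmod q + Cmod r + Cmod s).
Proof.
intros Hu Hv Bu Bv Hab.
assert (Ea : ((p * s - q * r) * a = s * u + - q * v)%C) by (rewrite <- Hu, <- Hv; ring).
assert (Eb : ((p * s - q * r) * b = p * v + - r * u)%C) by (rewrite <- Hu, <- Hv; ring).
apply (f_equal Cmod) in Ea, Eb.
rewrite Cmod_mult in Ea, Eb.
pose proof (Cmod_triangle (s * u)%C (- q * v)%C) as Ta.
pose proof (Cmod_triangle (p * v)%C (- r * u)%C) as Tb.
rewrite !Cmod_mult, !Cmod_opp in Ta, Tb.
set (n := Cmod (p * s - q * r)%C) in *.
apply (Rmult_le_reg_r (Cmod a + Cmod b)); [exact Hab|].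
pose proof (Cmod_ge_0 p); pose proof (Cmod_ge_0 q).
pose proof (Cmod_ge_0 r); pose proof (Cmod_ge_0 s).
pose proof (Rmult_le_compat_l _ _ _ H Bv).
pose proof (Rmult_le_compat_l _ _ _ H0 Bv).
pose proof (Rmult_le_compat_l _ _ _ H1 Bu).
pose proof (Rmult_le_compat_l _ _ _ H2 Bu).
lra.
Qed.

Lemma Cmod_le_sum (z : C) : Cmod z <= Rabs (fst z) + Rabs (snd z).
Proof.
replace z with (RtoC (fst z) + Ci * RtoC (snd z))%C at 1
  by (destruct z; unfold Ci, RtoC, Cplus, Cmult; simpl; f_equal; ring).
apply Rle_trans with (1 := Cmod_triangle _ _).
rewrite Cmod_mult, !Cmod_R.
replace (Cmod Ci) with 1; [lra|].
unfold Cmod, Ci; simpl; replace (0 * (0 * 1) + 1 * (1 * 1)) with 1 by ring.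
now rewrite sqrt_1.
Qed.

Lemma Rabs_re_im_le (z : C) : Rabs (fst z) + Rabs (snd z) <= 2 * Cmod z.
Proof.
pose proof (Rmax_Cmod z); pose proof (Rmax_l (Rabs (fst z)) (Rabs (snd z))).
pose proof (Rmax_r (Rabs (fst z)) (Rabs (snd z))); lra.
Qed.

(** Since [Q] and [lam] are real, real and imaginary parts solve the equation separately, and the
    perturbation result for real solutions applies to each. They are coupled only by the Floquet
    multiplier [exp_i (- phi)]. *)
Definition bloch_on (Q : R -> R) (lam T phi : R) (w w' : R -> C) : Prop :=
  hill_on Q lam T (fun z => fst (w z)) (fun z => fst (w' z)) /\
  hill_on Q lam T (fun z => snd (w z)) (fun z => snd (w' z)) /\
  w T = (exp_i (- phi) * w 0)%C /\ w' T = (exp_i (- phi) * w' 0)%C /\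
  exists z, 0 <= z <= T /\ w z <> 0%C.

(** This is the characteristic equation of a matrix of determinant [1] and trace [2 * cos phi]. *)
Lemma exp_i_sq (phi : R) :
  (exp_i (- phi) * exp_i (- phi) + 1 = RtoC (2 * cos phi) * exp_i (- phi))%C.
Proof.
unfold exp_i; rewrite cos_neg, sin_neg; pose proof (sin2_cos2 phi) as H; unfold Rsqr in H.
unfold RtoC, Cplus, Cmult; simpl; f_equal; nra.
Qed.

Lemma Cmod_exp_i (t : R) : Cmod (exp_i t) = 1.
Proof.
unfold Cmod, exp_i; simpl; pose proof (sin2_cos2 t) as H; unfold Rsqr in H.
replace (_ + _) with 1 by lra; apply sqrt_1.
Qed.

(** The initial data [(w 0, w' 0)] are almost an eigenvector, for the multiplier [rho], of the
    first-order expansion [B] of the monodromy matrix, so [det (B - rho)] is [O(d^2)]. As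
    [det B - 1] is [O(d^2)] too, the characteristic equation of [rho] shows that [tr B] agrees with
    [2 * cos phi] to that order. For [lam = lam0] the identity is exact. *)
Lemma bloch_discriminant (Q : R -> R) (lam0 T : R) (y1 y1' y2 y2' : R -> R) :
  0 < T -> hill_basis Q lam0 T y1 y1' y2 y2' ->
  exists K, forall (lam phi : R) (w w' : R -> C),
    bloch_on Q lam T phi w w' -> Rabs (lam - lam0) <= 1 ->
    Rabs (2 * cos phi - (y1 T + y2' T)
          - (lam - lam0) * discriminant_slope T y1 y1' y2 y2')
      <= K * (lam - lam0) ^ 2.
Proof.
intros HT Hy.
destruct (solution_perturbation Q lam0 T y1 y1' y2 y2' HT Hy) as [K [K0 HK]].
pose proof (wronskian_basis _ _ _ _ _ _ _ T Hy ltac:(lra)) as W.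
unfold discriminant_slope.
set (m11 := y1 T) in *; set (m12 := y2 T) in *; set (m21 := y1' T) in *; set (m22 := y2' T) in *.
set (J11 := overlap T y1 y1) in *; set (J12 := overlap T y1 y2) in *.
set (J22 := overlap T y2 y2) in *.
set (M := Rabs m11 + Rabs m12 + Rabs m21 + Rabs m22).
set (J := Rabs J11 + Rabs J12 + Rabs J22).
(* The product comes from [det2_bound]: four entries of size at most [M * (1 + J)], and [2] for the
   two occurrences of [rho] on the diagonal. The last term is the defect of [det B] from [1]. *)
exists (M * (2 * K) * (4 * (M * (1 + J)) + 2) + Rabs (J11 * J22 - J12 ^ 2)).
intros lam phi w w' [Hr [Hi [HT1 [HT2 [z0 [Hz0 Hnz]]]]]] Hd.
destruct (HK _ _ _ Hr Hd) as [Br [A1r [A2r [E1r [E2r [F1r F2r]]]]]].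
destruct (HK _ _ _ Hi Hd) as [Bi [A1i [A2i [E1i [E2i [F1i F2i]]]]]].
clear HK.
set (d := lam - lam0) in *.
set (a := w 0) in *; set (b := w' 0) in *.
(* With zero initial data the a priori bound would make [w] vanish on all of [[0,T]]. *)
assert (Hab : 0 < Cmod a + Cmod b).
{ destruct (Rle_lt_dec (Cmod a + Cmod b) 0) as [h|h]; [exfalso | exact h].
  pose proof (Rabs_re_im_le a); pose proof (Rabs_re_im_le b).
  specialize (Br z0 Hz0); specialize (Bi z0 Hz0).
  pose proof (Rabs_pos (fst a)); pose proof (Rabs_pos (snd a)).
  pose proof (Rabs_pos (fst b)); pose proof (Rabs_pos (snd b)).
  pose proof (Rabs_pos (fst (w z0))); pose proof (Rabs_pos (snd (w z0))).
  assert (Sr : Rabs (fst a) + Rabs (fst b) = 0) by lra.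
  assert (Si : Rabs (snd a) + Rabs (snd b) = 0) by lra.
  rewrite Sr in Br; rewrite Si in Bi.
  apply Hnz, Cmod_eq_0, Rle_antisym; [|apply Cmod_ge_0].
  apply Rle_trans with (1 := Cmod_le_sum _); lra. }
set (rho := exp_i (- phi)) in *.
set (A1 := (A1r, A1i) : C); set (A2 := (A2r, A2i) : C).
assert (HT1' : (A1 * RtoC m11 + A2 * RtoC m12 = rho * a)%C).
{ rewrite <- HT1; apply injective_projections; unfold A1, A2, Cplus, Cmult, RtoC; simpl.
  - rewrite E1r; ring.
  - rewrite E1i; ring. }
assert (HT2' : (A1 * RtoC m21 + A2 * RtoC m22 = rho * b)%C).
{ rewrite <- HT2; apply injective_projections; unfold A1, A2, Cplus, Cmult, RtoC; simpl.
  - rewrite E2r; ring.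
  - rewrite E2i; ring. }
set (r1 := (A1 - (a + RtoC d * (a * RtoC J12 + b * RtoC J22)))%C).
set (r2 := (A2 - (b - RtoC d * (a * RtoC J11 + b * RtoC J12)))%C).
assert (Sab : (Rabs (fst a) + Rabs (fst b)) + (Rabs (snd a) + Rabs (snd b))
   <= 2 * (Cmod a + Cmod b)).
{ pose proof (Rabs_re_im_le a); pose proof (Rabs_re_im_le b); lra. }
assert (Kd : 0 <= K * d ^ 2) by (apply Rmult_le_pos; auto; apply pow2_ge_0).
assert (R1 : Cmod r1 <= 2 * K * d ^ 2 * (Cmod a + Cmod b)).
{ apply Rle_trans with (1 := Cmod_le_sum _).
  replace (fst r1) with (A1r - (fst a + d * (fst a * J12 + fst b * J22)))
    by (unfold r1, A1, Cminus, Cplus, Copp, Cmult, RtoC; simpl; ring).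
  replace (snd r1) with (A1i - (snd a + d * (snd a * J12 + snd b * J22)))
    by (unfold r1, A1, Cminus, Cplus, Copp, Cmult, RtoC; simpl; ring).
  nra. }
assert (R2 : Cmod r2 <= 2 * K * d ^ 2 * (Cmod a + Cmod b)).
{ apply Rle_trans with (1 := Cmod_le_sum _).
  replace (fst r2) with (A2r - (fst b - d * (fst a * J11 + fst b * J12)))
    by (unfold r2, A2, Cminus, Cplus, Copp, Cmult, RtoC; simpl; ring).
  replace (snd r2) with (A2i - (snd b - d * (snd a * J11 + snd b * J12)))
    by (unfold r2, A2, Cminus, Cplus, Copp, Cmult, RtoC; simpl; ring).
  nra. }
set (e := M * (2 * K) * d ^ 2).
(* The entries of [B]: the monodromy matrix at [lam0] applied to the first-order coordinates. *)
set (b11 := m11 * (1 + d * J12) + m12 * (- d * J11)).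
set (b12 := m11 * (d * J22) + m12 * (1 - d * J12)).
set (b21 := m21 * (1 + d * J12) + m22 * (- d * J11)).
set (b22 := m21 * (d * J22) + m22 * (1 - d * J12)).
assert (MB : forall m n x y : R, Rabs m + Rabs n <= M -> Rabs x <= 1 + J ->
   Rabs y <= 1 + J -> Rabs (m * x + n * y) <= M * (1 + J)).
{ intros m n x y Hm Hx Hy'.
  apply Rle_trans with (1 := Rabs_triang _ _); rewrite !Rabs_mult.
  apply Rle_trans with ((Rabs m + Rabs n) * (1 + J)).
  - rewrite Rmult_plus_distr_r; apply Rplus_le_compat;
    apply Rmult_le_compat_l; auto using Rabs_pos.
  - apply Rmult_le_compat_r; auto; pose proof (Rabs_pos x); lra. }
assert (MC : forall m n : R, Rabs m + Rabs n <= M ->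
   Cmod (- (RtoC m * r1 + RtoC n * r2))%C <= e * (Cmod a + Cmod b)).
{ intros m n Hm; rewrite Cmod_opp.
  apply Rle_trans with (1 := Cmod_triangle _ _); rewrite !Cmod_mult, !Cmod_R.
  apply Rle_trans with ((Rabs m + Rabs n) * (2 * K * d ^ 2 * (Cmod a + Cmod b))).
  - rewrite Rmult_plus_distr_r; apply Rplus_le_compat;
    apply Rmult_le_compat_l; auto using Rabs_pos.
  - unfold e; replace (M * (2 * K) * d ^ 2 * (Cmod a + Cmod b))
      with (M * (2 * K * d ^ 2 * (Cmod a + Cmod b))) by ring.
    apply Rmult_le_compat_r; auto. apply Rle_trans with (2 := R1), Cmod_ge_0. }
pose proof (Rabs_pos m11); pose proof (Rabs_pos m12).
pose proof (Rabs_pos m21); pose proof (Rabs_pos m22).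
pose proof (Rabs_pos J11); pose proof (Rabs_pos J12); pose proof (Rabs_pos J22).
assert (DJ : forall x, Rabs x <= J -> Rabs (d * x) <= J).
{ intros x Hx; rewrite Rabs_mult; pose proof (Rabs_pos x); pose proof (Rabs_pos d); nra. }
assert (j11 : Rabs (- d * J11) <= J).
{ replace (- d * J11) with (d * - J11) by ring; apply DJ; rewrite Rabs_Ropp; unfold J; lra. }
assert (j12 : Rabs (d * J12) <= J) by (apply DJ; unfold J; lra).
assert (j22 : Rabs (d * J22) <= J) by (apply DJ; unfold J; lra).
apply Rabs_le_between in j12.
assert (B11 : Rabs b11 <= M * (1 + J)).
{ apply MB; [unfold M; lra | apply Rabs_le_between; lra | lra]. }
assert (B12 : Rabs b12 <= M * (1 + J)).
{ apply MB; [unfold M; lra | lra | apply Rabs_le_between; lra]. }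
assert (B21 : Rabs b21 <= M * (1 + J)).
{ apply MB; [unfold M; lra | apply Rabs_le_between; lra | lra]. }
assert (B22 : Rabs b22 <= M * (1 + J)).
{ apply MB; [unfold M; lra | lra | apply Rabs_le_between; lra]. }
assert (Det := det2_bound (RtoC b11 - rho)%C (RtoC b12) (RtoC b21) (RtoC b22 - rho)%C
  a b (- (RtoC m11 * r1 + RtoC m12 * r2))%C (- (RtoC m21 * r1 + RtoC m22 * r2))%C e).
assert (Det' : Cmod ((RtoC b11 - rho) * (RtoC b22 - rho) - RtoC b12 * RtoC b21)%C
   <= e * (4 * (M * (1 + J)) + 2)).
{ eapply Rle_trans; [apply Det|].
  - unfold b11, b12, r1, r2; unfold Rminus; rewrite ?RtoC_plus, ?RtoC_mult, ?RtoC_plus, ?RtoC_opp, ?RtoC_mult, ?RtoC_opp.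
    transitivity (rho * a - rho * a + (RtoC m11 * (a + RtoC d * (a * RtoC J12 + b * RtoC J22)) + RtoC m12 * (b - RtoC d * (a * RtoC J11 + b * RtoC J12))) - rho * a)%C; [ring|].
    rewrite <- HT1' at 3; ring.
  - unfold b21, b22, r1, r2; unfold Rminus; rewrite ?RtoC_plus, ?RtoC_mult, ?RtoC_plus, ?RtoC_opp, ?RtoC_mult, ?RtoC_opp.
    transitivity (rho * b - rho * b + (RtoC m21 * (a + RtoC d * (a * RtoC J12 + b * RtoC J22)) + RtoC m22 * (b - RtoC d * (a * RtoC J11 + b * RtoC J12))) - rho * b)%C; [ring|].
    rewrite <- HT2' at 3; ring.
  - apply MC; unfold M; lra.
  - apply MC; unfold M; lra.
  - exact Hab.
  - apply Rmult_le_compat_l.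
    + unfold e; apply Rmult_le_pos; [apply Rmult_le_pos; [unfold M|]; lra | apply pow2_ge_0].
    + rewrite !Cmod_R.
      pose proof (Cmod_triangle (RtoC b11) (- rho)%C) as t1.
      pose proof (Cmod_triangle (RtoC b22) (- rho)%C) as t2.
      rewrite Cmod_R, Cmod_opp in t1, t2.
      assert (N : Cmod rho = 1) by apply Cmod_exp_i.
      unfold Cminus; lra. }
assert (DetE : ((RtoC b11 - rho) * (RtoC b22 - rho) - RtoC b12 * RtoC b21
   = rho * RtoC (2 * cos phi - (b11 + b22)) + RtoC (b11 * b22 - b12 * b21 - 1))%C).
{ assert (X := exp_i_sq phi); fold rho in X.
  unfold Rminus; rewrite !RtoC_plus, !RtoC_opp, !RtoC_plus, !RtoC_mult.
  rewrite RtoC_mult in X.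
  transitivity (rho * rho + 1 - rho * (RtoC b11 + RtoC b22)
     + (RtoC b11 * RtoC b22 - RtoC b12 * RtoC b21 - 1))%C; [ring|].
  rewrite X; ring. }
assert (DB : b11 * b22 - b12 * b21 - 1 = d ^ 2 * (J11 * J22 - J12 ^ 2)).
{ transitivity ((m11 * m22 - m21 * m12) * (1 + d ^ 2 * (J11 * J22 - J12 ^ 2)) - 1).
  - unfold b11, b12, b21, b22; ring.
  - rewrite W; ring. }
rewrite DB in DetE.
replace (2 * cos phi - (m11 + m22) - d * (- m12 * J11 + (m11 - m22) * J12 + m21 * J22))
  with (2 * cos phi - (b11 + b22)) by (unfold b11, b22; ring).
set (X := 2 * cos phi - (b11 + b22)) in *.
assert (EX : (rho * RtoC X = ((RtoC b11 - rho) * (RtoC b22 - rho) - RtoC b12 * RtoC b21)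
  + - RtoC (d ^ 2 * (J11 * J22 - J12 ^ 2)))%C) by (rewrite DetE; ring).
apply (f_equal Cmod) in EX.
rewrite Cmod_mult, Cmod_R in EX; unfold rho at 1 in EX; rewrite Cmod_exp_i in EX.
rewrite Rmult_1_l in EX; rewrite EX.
apply Rle_trans with (1 := Cmod_triangle _ _).
rewrite Cmod_opp, Cmod_R, Rabs_mult, (Rabs_pos_eq (d ^ 2)) by apply pow2_ge_0.
unfold e in Det'; lra.
Qed.

(** Being differentiable with value [0] at [x0], [delta] is [O(x - x0)], so the error is
    [O((x - x0)^2)] and has derivative [0]. Differentiability of [f] is thus a conclusion. *)
Lemma is_derive_quadratic_error (f delta : R -> R) (x0 f0 l d K : R) :
  is_derive delta x0 d -> delta x0 = 0 ->
  locally x0 (fun x => Rabs (f x - f0 - delta x * l) <= K * delta x ^ 2) ->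
  is_derive f x0 (d * l).
Proof.
intros Hd H0 HL.
set (r := fun x => f x - f0 - delta x * l).
assert (f00 : r x0 = 0).
{ pose proof (locally_singleton _ _ HL) as h; cbv beta in h.
  unfold r; rewrite H0 in *; replace (K * 0 ^ 2) with 0 in h by ring.
  pose proof (Rabs_pos (f x0 - f0 - 0 * l)).
  destruct (Req_dec (f x0 - f0 - 0 * l) 0) as [e|e]; [exact e|].
  apply Rabs_no_R0 in e; lra. }
assert (Hr : is_derive r x0 0).
{ split; [apply is_linear_scal_l|].
  intros x Hx; rewrite <- (is_filter_lim_locally_unique (V := AbsRing_NormedModule R_AbsRing) x0 x Hx); clear x Hx.
  intros eps.
  destruct Hd as [_ Hd]; specialize (Hd x0 (fun P h => h) (mkposreal 1 Rlt_0_1)).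
  (* Differentiability with tolerance [1] gives [Rabs (delta x) <= (Rabs d + 1) * Rabs (x - x0)]
     near [x0]. *)
  set (L := Rabs d + 1) in *.
  assert (L0 : 0 < L) by (unfold L; pose proof (Rabs_pos d); lra).
  assert (B : locally x0 (fun x => Rabs (delta x) <= L * Rabs (x - x0))).
  { revert Hd; apply filter_imp; intros x Hx.
    unfold minus, plus, opp, scal, norm in Hx; simpl in Hx; unfold abs, mult in Hx; simpl in Hx.
    rewrite H0 in Hx.
    pose proof (Rabs_triang (delta x - 0 + - ((x - x0) * d)) ((x - x0) * d)) as t.
    rewrite Rabs_mult in t.
    replace (delta x - 0 + - ((x - x0) * d) + (x - x0) * d) with (delta x) in t by ring.
    unfold L, Rminus in *; lra. }
  assert (Keps : 0 < eps / ((Rabs K + 1) * L ^ 2)).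
  { apply Rdiv_lt_0_compat; [apply eps|]; apply Rmult_lt_0_compat.
    - pose proof (Rabs_pos K); lra.
    - apply pow_lt, L0. }
  assert (N : locally x0 (fun x => Rabs (x - x0) < eps / ((Rabs K + 1) * L ^ 2))).
  { exists (mkposreal _ Keps); intros x Hx; exact Hx. }
  generalize (filter_and _ _ HL (filter_and _ _ B N)).
  apply filter_imp; intros x [h1 [h2 h3]].
  unfold minus, plus, opp, scal, norm; simpl; unfold abs, mult; simpl.
  rewrite f00; fold (r x) in h1.
  replace (r x + - 0 + - ((x + - x0) * 0)) with (r x) by ring.
  change (x + - x0) with (x - x0).
  apply Rle_trans with (1 := h1).
  pose proof (Rle_abs K); pose proof (Rabs_pos K).
  pose proof (Rabs_pos (delta x)).
  rewrite <- (pow2_abs (delta x)).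
  assert (h4 : Rabs (delta x) ^ 2 <= L ^ 2 * Rabs (x - x0) ^ 2).
  { rewrite <- Rpow_mult_distr; apply pow_incr; lra. }
  apply Rle_trans with ((Rabs K + 1) * (L ^ 2 * Rabs (x - x0) ^ 2)).
  { apply Rle_trans with ((Rabs K + 1) * Rabs (delta x) ^ 2).
    - apply Rmult_le_compat_r; [apply pow2_ge_0 | lra].
    - apply Rmult_le_compat_l; lra. }
  apply Rlt_div_r in h3.
  - pose proof (Rabs_pos (x - x0)). nra.
  - apply Rmult_lt_0_compat; [lra|apply pow_lt, L0]. }
apply (is_derive_ext (fun x => f0 + delta x * l + r x)).
- intros x; unfold r; simpl; ring.
- auto_derive.
  + repeat split; eexists; eassumption.
  + derive_with Hd; derive_with Hr; ring.
Qed.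

(** * From the pencil to Hill's equation and back *)

(** Composing with this retraction onto [[0,T]] turns one-sided continuity at the endpoints into
    continuity on the line. *)
Definition clamp (T z : R) : R := Rmax 0 (Rmin z T).

Lemma clamp_id (T z : R) : 0 <= z <= T -> clamp T z = z.
Proof. intros Hz; unfold clamp; rewrite Rmin_left, Rmax_right; lra. Qed.

Lemma clamp_in (T z : R) : 0 < T -> on_interval T (clamp T z).
Proof.
intros HT; unfold clamp, on_interval, Rmax, Rmin.
destruct (Rle_dec z T); destruct (Rle_dec _ _); lra.
Qed.

Lemma clamp_contract (T x z : R) : Rabs (clamp T x - clamp T z) <= Rabs (x - z).
Proof.
unfold clamp, Rmax, Rmin, Rabs.
repeat (destruct (Rle_dec _ _)); repeat (destruct (Rcase_abs _)); lra.
Qed.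

(** To be used with [pi] the real or the imaginary part. The retraction is a contraction, which
    gives continuity, and it is the identity near interior points, which gives the derivative. *)
Lemma derivative_in_component (T : R) (f f' : R -> C) (pi : C -> R) :
  is_linear (U := C_R_NormedModule) (V := R_NormedModule) pi ->
  0 < T -> derivative_in T f f' ->
  (forall z, continuous (fun x => pi (f (clamp T x))) z) /\
  (forall z, 0 < z < T -> is_derive (fun x => pi (f (clamp T x))) z (pi (f' z))).
Proof.
intros Lpi HT Hf.
assert (D : forall z, on_interval T z ->
  filterdiff (K := R_AbsRing) (U := R_NormedModule) (V := R_NormedModule)
    (fun x => pi (f x)) (locally_in T z) (fun h => scal h (pi (f' z)))).
{ intros z Hz.
  apply (filterdiff_ext_lin _ (fun h => pi (@scal R_AbsRing C_R_NormedModule h (f' z)))).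
  - apply (filterdiff_comp (K := R_AbsRing) (V := C_R_NormedModule)).
    + apply Hf, Hz.
    + apply filterdiff_linear, Lpi.
  - intros h; apply (linear_scal (K := R_AbsRing) (U := C_R_NormedModule) (V := R_NormedModule) pi Lpi). }
split.
- intros z.
  pose proof (clamp_in T z HT) as Hz.
  apply (filterlim_comp R R R (clamp T) (fun x => pi (f x)) (locally z) (locally_in T (clamp T z))).
  + intros P [eps HP]; exists eps; intros x Hx.
    apply HP; [|apply clamp_in, HT].
    apply Rle_lt_trans with (2 := Hx); apply clamp_contract.
  + apply (filterdiff_continuous_aux (K := R_AbsRing) (U := R_NormedModule)
      (V := R_NormedModule) (F := locally_in T (clamp T z)) (fun x => pi (f x))) with (x := clamp T z).
    * eexists; apply D, Hz.
    * intros P HP; apply filter_le_within; exact HP.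
- intros z Hz.
  assert (N : locally z (fun x => 0 < x < T)).
  { apply filter_and; [apply (open_gt 0) | apply (open_lt T)]; apply Hz. }
  apply (is_derive_ext_loc (fun x => pi (f x))).
  { revert N; apply filter_imp; intros x Hx; rewrite clamp_id; [reflexivity | lra]. }
  destruct (D z) as [L H]; [unfold on_interval; lra|].
  split; [exact L|].
  intros x Hx eps.
  rewrite <- (is_filter_lim_locally_unique (V := AbsRing_NormedModule R_AbsRing) z x Hx).
  assert (Hl : is_filter_lim (locally_in T z) z)
    by (intros P HP; apply filter_le_within; exact HP).
  generalize (filter_and _ _ N (H z Hl eps)); apply filter_imp.
  intros y [Hy1 Hy2]; apply Hy2; unfold on_interval; lra.
Qed.

Definition potential (c : R) (U : R -> R) (z : R) : R := cos (U z) / (c ^ 2 - 1).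

Definition spectral (c zeta : R) : R := zeta ^ 2 / (c ^ 2 - 1) ^ 2.

Definition bloch_phase (c T theta zeta : R) : R := c * zeta * T / (c ^ 2 - 1) + theta.

(* The gauge [w = exp (- i k z) p], [k = c zeta / (c^2 - 1)], removes the first-order
   term of the pencil. *)
Lemma eigenfunction_bloch (c : R) (U : R -> R) (T theta zeta m : R) (p : C2 T) :
  c ^ 2 <> 1 -> 0 < T -> quasi_periodic theta p -> nonzero_in p ->
  (forall z, on_interval T z -> L_SG c U (RtoC zeta) p z = Cmult (RtoC m) (p z)) ->
  exists w w', bloch_on (potential c U) (spectral c zeta - m) T
                 (bloch_phase c T theta zeta) w w'.
Proof.
intros hc HT [Qp Qp'] [z0 [Hz0 Hnz]] HL.
assert (a0 : c ^ 2 - 1 <> 0) by lra.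
set (k := c * zeta / (c ^ 2 - 1)).
destruct p as [p p1 p2 P1 P2 P3]; simpl in *.
destruct (derivative_in_component T p p1 fst is_linear_fst HT P1) as [Cr Dr].
destruct (derivative_in_component T p p1 snd is_linear_snd HT P1) as [Ci' Di].
destruct (derivative_in_component T p1 p2 fst is_linear_fst HT P2) as [Cr1 Dr1].
destruct (derivative_in_component T p1 p2 snd is_linear_snd HT P2) as [Ci1 Di1].
(* Real and imaginary parts of the pencil equation, solved for the second derivative of [p]. *)
assert (HLr : forall z, 0 < z < T -> fst (p2 z) =
  - 2 * k * snd (p1 z) + (zeta ^ 2 / (c ^ 2 - 1) - potential c U z + m) * fst (p z)).
{ intros z Hz; assert (Hz' : on_interval T z) by (unfold on_interval; lra).
  specialize (HL z Hz'); apply (f_equal fst) in HL.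
  unfold L_SG, Ci, RtoC, Cdiv, Cinv, Cminus, Cplus, Copp, Cmult in HL; simpl in HL.
  unfold potential, k.
  match type of HL with ?l = _ =>
    replace (fst (p2 z)) with
     (fst (p2 z) - l + (m * fst (p z) - 0 * snd (p z))) by (rewrite HL; ring) end.
  field; auto. }
assert (HLi : forall z, 0 < z < T -> snd (p2 z) =
  2 * k * fst (p1 z) + (zeta ^ 2 / (c ^ 2 - 1) - potential c U z + m) * snd (p z)).
{ intros z Hz; assert (Hz' : on_interval T z) by (unfold on_interval; lra).
  specialize (HL z Hz'); apply (f_equal snd) in HL.
  unfold L_SG, Ci, RtoC, Cdiv, Cinv, Cminus, Cplus, Copp, Cmult in HL; simpl in HL.
  unfold potential, k.
  match type of HL with ?l = _ =>
    replace (snd (p2 z)) with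
     (snd (p2 z) - l + (m * snd (p z) + 0 * fst (p z))) by (rewrite HL; ring) end.
  field; auto. }
set (pr := fun z => fst (p (clamp T z))) in *.
set (pi := fun z => snd (p (clamp T z))) in *.
set (pr1 := fun z => fst (p1 (clamp T z))) in *.
set (pi1 := fun z => snd (p1 (clamp T z))) in *.
(* Removing the first-order term contributes [k^2], which combines with the term in [zeta^2] of the
   pencil to Hill's spectral parameter. *)
assert (Kq : k ^ 2 + zeta ^ 2 / (c ^ 2 - 1) * -1 = spectral c zeta)
  by (unfold k, spectral; field; auto).
(* In complex form [w = exp(-ikz) p] and [w' = exp(-ikz) (p1 - ik p)]. *)
set (w := fun z => (cos (k * z) * pr z + sin (k * z) * pi z,
                    cos (k * z) * pi z - sin (k * z) * pr z) : C).
set (w' := fun z => (cos (k * z) * (pr1 z + k * pi z) + sin (k * z) * (pi1 z - k * pr z),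
                     cos (k * z) * (pi1 z - k * pr z) - sin (k * z) * (pr1 z + k * pi z)) : C).
assert (Cc : forall z, continuous (fun x => cos (k * x)) z).
{ intros z; apply (ex_derive_continuous (fun x => cos (k * x))); auto_derive; auto. }
assert (Cs : forall z, continuous (fun x => sin (k * x)) z).
{ intros z; apply (ex_derive_continuous (fun x => sin (k * x))); auto_derive; auto. }
assert (c0 : clamp T 0 = 0) by (apply clamp_id; lra).
assert (cT : clamp T T = T) by (apply clamp_id; lra).
assert (Hclamp : forall z, 0 < z < T -> fst (p z) = pr z /\ snd (p z) = pi z /\
   fst (p1 z) = pr1 z /\ snd (p1 z) = pi1 z).
{ intros z Hz; unfold pr, pi, pr1, pi1; rewrite clamp_id by lra; auto. }
assert (Ph : bloch_phase c T theta zeta = k * T + theta)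
  by (unfold bloch_phase, k; field; lra).
exists w, w'; unfold bloch_on; rewrite Ph; unfold hill_on.
split; [split | split; [split | split; [|split]]];
  try (intros z; split; simpl; cont; auto; fail);
  try (intros z H; split).
- destruct (Hclamp z H) as [E1 [E2 [E3 E4]]].
  pose proof (Dr z H : is_derive pr z _) as h1; pose proof (Di z H : is_derive pi z _) as h2.
  simpl; auto_derive.
  + repeat split; eexists; eassumption.
  + derive_with h1; derive_with h2; rewrite E3, E4; ring.
- destruct (Hclamp z H) as [E1 [E2 [E3 E4]]].
  pose proof (Dr z H : is_derive pr z _) as h1; pose proof (Di z H : is_derive pi z _) as h2.
  pose proof (Dr1 z H : is_derive pr1 z _) as h3; pose proof (Di1 z H : is_derive pi1 z _) as h4.
  rewrite HLr in h3 by auto; rewrite HLi in h4 by auto.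
  simpl; auto_derive.
  + repeat split; eexists; eassumption.
  + derive_with h1; derive_with h2; derive_with h3; derive_with h4.
    rewrite E1, E2, E3, E4, <- Kq; ring.
- destruct (Hclamp z H) as [E1 [E2 [E3 E4]]].
  pose proof (Dr z H : is_derive pr z _) as h1; pose proof (Di z H : is_derive pi z _) as h2.
  simpl; auto_derive.
  + repeat split; eexists; eassumption.
  + derive_with h1; derive_with h2; rewrite E3, E4; ring.
- destruct (Hclamp z H) as [E1 [E2 [E3 E4]]].
  pose proof (Dr z H : is_derive pr z _) as h1; pose proof (Di z H : is_derive pi z _) as h2.
  pose proof (Dr1 z H : is_derive pr1 z _) as h3; pose proof (Di1 z H : is_derive pi1 z _) as h4.
  rewrite HLr in h3 by auto; rewrite HLi in h4 by auto.
  simpl; auto_derive.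
  + repeat split; eexists; eassumption.
  + derive_with h1; derive_with h2; derive_with h3; derive_with h4.
    rewrite E1, E2, E3, E4, <- Kq; ring.
- unfold w, pr, pi; rewrite c0, cT, Qp.
  unfold exp_i, Cmult; simpl; rewrite !cos_neg, !sin_neg, cos_plus, sin_plus.
  rewrite Rmult_0_r, cos_0, sin_0; f_equal; ring.
- unfold w', pr, pi, pr1, pi1; rewrite c0, cT, Qp, Qp'.
  unfold exp_i, Cmult; simpl; rewrite !cos_neg, !sin_neg, cos_plus, sin_plus.
  rewrite Rmult_0_r, cos_0, sin_0; f_equal; ring.
- exists z0; split; [exact Hz0|]; intros E; apply Hnz.
  unfold on_interval in Hz0.
  unfold w, pr, pi in E; rewrite clamp_id in E by auto.
  injection E as Er Ei.
  pose proof (sin2_cos2 (k * z0)) as sc; unfold Rsqr in sc.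
  set (cc := cos (k * z0)) in *; set (ss := sin (k * z0)) in *.
  apply injective_projections; simpl.
  + transitivity ((ss * ss + cc * cc) * fst (p z0)); [rewrite sc; ring|].
    transitivity (cc * (cc * fst (p z0) + ss * snd (p z0))
      - ss * (cc * snd (p z0) - ss * fst (p z0))); [ring|].
    rewrite Er, Ei; ring.
  + transitivity ((ss * ss + cc * cc) * snd (p z0)); [rewrite sc; ring|].
    transitivity (ss * (cc * fst (p z0) + ss * snd (p z0))
      + cc * (cc * snd (p z0) - ss * fst (p z0))); [ring|].
    rewrite Er, Ei; ring.
Qed.

Lemma is_derive_pair (f g : R -> R) (z l m : R) :
  is_derive f z l -> is_derive g z m ->
  is_derive (K := R_AbsRing) (V := C_R_NormedModule) (fun x => (f x, g x)) z (l, m).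
Proof.
intros Hf Hg.
apply (is_derive_ext (K := R_AbsRing) (V := C_R_NormedModule)
  (fun x => plus (@scal R_AbsRing C_R_NormedModule (f x) (1, 0))
                 (@scal R_AbsRing C_R_NormedModule (g x) (0, 1)))).
- intros x; apply injective_projections;
  unfold plus, scal; simpl; unfold plus, scal, mult; simpl; unfold mult; simpl; ring.
- replace ((l, m) : C) with (plus (@scal R_AbsRing C_R_NormedModule l (1, 0))
                 (@scal R_AbsRing C_R_NormedModule m (0, 1))).
  + apply (is_derive_plus (K := R_AbsRing) (V := C_R_NormedModule));
    apply (is_derive_scal_l (K := R_AbsRing) (V := C_R_NormedModule)); assumption.
  + apply injective_projections;
    unfold plus, scal; simpl; unfold plus, scal, mult; simpl; unfold mult; simpl; ring.
Qed.

Lemma locally_in_proper (T z : R) :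
  0 < T -> on_interval T z -> ProperFilter (locally_in T z).
Proof.
intros HT Hz; unfold locally_in; constructor.
- intros P [eps HP]; exists z; apply HP; [apply ball_center | exact Hz].
- apply within_filter, locally_filter.
Qed.

Lemma derivative_in_of_is_derive (T : R) (f f' : R -> C) :
  0 < T ->
  (forall z, is_derive (K := R_AbsRing) (V := C_R_NormedModule) f z (f' z)) ->
  derivative_in T f f'.
Proof.
intros HT H z Hz.
pose proof (locally_in_proper T z HT Hz) as PF.
apply (filterdiff_locally (K := R_AbsRing) (U := R_NormedModule)
  (V := C_R_NormedModule) f z); [|apply H].
intros P HP; apply filter_le_within; exact HP.
Qed.

Lemma hill_solution_derive (c : R) (U : R -> R) (zeta : R) (q : R -> R) (z : R) :
  hill_solution c U zeta q ->
  is_derive q z (Derive q z) /\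
  is_derive (Derive q) z (- (spectral c zeta + potential c U z) * q z).
Proof.
intros H; destruct (H z) as [d1 [d2 E]].
split; [apply Derive_correct, d1|].
replace (- (spectral c zeta + potential c U z) * q z) with (Derive (Derive q) z).
- apply Derive_correct, d2.
- change (Derive (Derive q) z) with (Derive_n q 2 z); unfold spectral, potential; lra.
Qed.

Lemma hill_solution_on (c : R) (U : R -> R) (T zeta : R) (q : R -> R) :
  hill_solution c U zeta q ->
  hill_on (potential c U) (spectral c zeta) T q (Derive q).
Proof.
intros H; split.
- intros z; destruct (hill_solution_derive _ _ _ _ z H) as [d1 d2].
  split; [apply (ex_derive_continuous q) | apply (ex_derive_continuous (Derive q))];
  eexists; eassumption.
- intros z _; apply hill_solution_derive, H.
Qed.

(* Inverse of the gauge of [eigenfunction_bloch]. *)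
Lemma hill_solution_in_kernel (c : R) (U : R -> R) (T theta zeta m : R) (y : R -> R) :
  c ^ 2 <> 1 -> 0 < T -> (forall z, continuous U z) -> hill_solution c U zeta y ->
  exp_i (- bloch_phase c T theta zeta) = RtoC m ->
  y T = m * y 0 -> Derive y T = m * Derive y 0 ->
  exists p : C2 T, in_kernel c U T theta (RtoC zeta) p /\
    forall z, p z = (exp_i (c * zeta / (c ^ 2 - 1) * z) * RtoC (y z))%C.
Proof.
intros hc HT HU Hy Hm Y0 Y1.
assert (a0 : c ^ 2 - 1 <> 0) by lra.
set (k := c * zeta / (c ^ 2 - 1)).
set (y' := Derive y).
set (y2 := fun z => - (spectral c zeta + potential c U z) * y z).
assert (D1 : forall z, is_derive y z (y' z)) by (intros z; apply (hill_solution_derive _ _ _ _ z Hy)).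
assert (D2 : forall z, is_derive y' z (y2 z)) by (intros z; apply (hill_solution_derive _ _ _ _ z Hy)).
set (p := fun z => (cos (k * z) * y z, sin (k * z) * y z) : C).
set (p1 := fun z => (cos (k * z) * y' z - k * sin (k * z) * y z,
                     sin (k * z) * y' z + k * cos (k * z) * y z) : C).
set (p2 := fun z => (cos (k * z) * y2 z - 2 * k * sin (k * z) * y' z - k ^ 2 * cos (k * z) * y z,
                     sin (k * z) * y2 z + 2 * k * cos (k * z) * y' z - k ^ 2 * sin (k * z) * y z) : C).
assert (P1 : derivative_in T p p1).
{ apply derivative_in_of_is_derive; [exact HT|]; intros z.
  pose proof (D1 z) as h1.
  apply is_derive_pair; auto_derive;
    try (repeat split; eexists; eassumption); derive_with h1; ring. }
assert (P2 : derivative_in T p1 p2).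
{ apply derivative_in_of_is_derive; [exact HT|]; intros z.
  pose proof (D1 z) as h1; pose proof (D2 z) as h2.
  clearbody y'.
  apply is_derive_pair; auto_derive;
    try (repeat split; eexists; eassumption); derive_with h1; derive_with h2; ring. }
assert (P3 : continuous_in T p2).
{ intros z _.
  assert (Cc : continuous (fun x => cos (k * x)) z).
  { apply (ex_derive_continuous (fun x => cos (k * x))); auto_derive; auto. }
  assert (Cs : continuous (fun x => sin (k * x)) z).
  { apply (ex_derive_continuous (fun x => sin (k * x))); auto_derive; auto. }
  assert (Cy : continuous y z) by (apply (ex_derive_continuous y); eexists; apply D1).
  assert (Cy' : continuous y' z) by (apply (ex_derive_continuous y'); eexists; apply D2).
  assert (Cp : continuous (fun x => potential c U x) z).
  { unfold potential, Rdiv; cont.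
    apply (continuous_comp U cos); [apply HU | apply continuous_cos]. }
  assert (Cy2 : continuous y2 z).
  { unfold y2. apply (continuous_ext (fun x => (-1) * (spectral c zeta + potential c U x) * y x)).
    - intros x; simpl; ring.
    - cont. }
  apply (filterlim_filter_le_1 (F := locally z)); [apply filter_le_within|].
  apply (filterlim_locally (U := C_UniformSpace)); intros eps.
  assert (Hr : continuous (fun x => fst (p2 x)) z) by (unfold p2; simpl; cont).
  assert (Hi : continuous (fun x => snd (p2 x)) z) by (unfold p2; simpl; cont).
  generalize (filter_and _ _ (proj1 (filterlim_locally _ _) Hr eps)
    (proj1 (filterlim_locally _ _) Hi eps)).
  apply filter_imp; intros x [h1 h2]; split; assumption. }
exists (mkC2 T p p1 p2 P1 P2 P3); split; [split|].
- assert (E : (exp_i (k * T) * RtoC m = exp_i (- theta))%C).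
  { rewrite <- Hm.
    replace (- theta) with (k * T + - bloch_phase c T theta zeta)
      by (unfold bloch_phase, k; field; auto).
    unfold exp_i, Cmult; simpl; rewrite cos_plus, sin_plus; f_equal; ring. }
  unfold quasi_periodic; simpl; rewrite <- E.
  unfold p, p1; rewrite Y0; unfold y'; rewrite Y1, Rmult_0_r, cos_0, sin_0.
  unfold exp_i, Cmult, RtoC; simpl; split; f_equal; ring.
- intros z _; unfold L_SG; simpl.
  apply injective_projections;
  unfold p, p1, p2, y2, spectral, potential, k, Ci, RtoC, Cdiv, Cinv, Cminus, Cplus, Copp, Cmult;
  simpl; field; lra.
- intros z; simpl; unfold p, exp_i, RtoC, Cmult; simpl; f_equal; ring.
Qed.

(** Convergence at distance [eps / 2] rules out a zero radius of convergence, as the terms of the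
    series would not tend to [0] there. *)
Lemma analytic_at_derivable (f : R -> R) (x0 : R) : analytic_at f x0 -> ex_derive f x0.
Proof.
intros [a [eps H]].
assert (R0 : Rbar_lt 0 (CV_radius a)).
{ apply Rbar_not_le_lt; intros Hle.
  destruct eps as [e He]; simpl in H.
  assert (Ab : Rabs (e / 2) = e / 2) by (apply Rabs_pos_eq; lra).
  apply (CV_disk_outside a (e / 2)).
  - rewrite Ab; apply Rbar_le_lt_trans with (1 := Hle); simpl; lra.
  - apply ex_series_lim_0.
    specialize (H (x0 + e / 2)); replace (x0 + e / 2 - x0) with (e / 2) in H by ring.
    rewrite Ab in H; specialize (H ltac:(lra)).
    exists (f (x0 + e / 2)).
    apply (is_series_ext (fun n => scal (pow_n (e / 2) n) (a n))); [|exact H].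
    intros n; rewrite pow_n_pow; unfold scal; simpl; unfold mult; simpl; ring. }
apply (ex_derive_ext_loc (fun x => PSeries a (x - x0))).
- exists eps; intros x Hx; apply is_pseries_unique, H, Hx.
- eexists.
  apply (is_derive_comp (K := R_AbsRing) (V := R_NormedModule) (PSeries a) (fun x => x - x0)).
  + apply is_derive_PSeries; replace (x0 - x0) with 0 by ring; rewrite Rabs_R0; exact R0.
  + auto_derive; auto.
Qed.

(** * The standing wave at spectral parameter zero *)

(* [U (z + T) - U z] is continuous with values in [2 PI Z], hence locally constant. *)
Lemma standing_wave_derive_periodic (c : R) (U : R -> R) (T z : R) :
  standing_wave c U T -> Derive U (z + T) = Derive U z.
Proof.
intros [HU [_ [_ [Hper _]]]].
assert (dU : forall x, ex_derive U x) by (intros x; apply HU).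
set (g := fun x => U (x + T) - U x).
assert (Dg : is_derive g z (Derive U (z + T) - Derive U z)).
{ unfold g; auto_derive.
  - repeat split; auto.
  - rewrite !Rmult_1_l; reflexivity. }
assert (Cg : continuous g z) by (apply (ex_derive_continuous g); eexists; exact Dg).
pose proof PI_RGT_0 as HPI.
(* Two multiples of [2 * PI] at distance less than [PI] coincide. *)
assert (L : locally z (fun x => g z = g x)).
{ pose proof (proj1 (filterlim_locally _ _) Cg (mkposreal PI HPI)) as N.
  revert N; apply filter_imp; intros x Hx.
  apply Rabs_lt_between' in Hx; simpl in Hx; unfold g in *.
  destruct (Hper z) as [n Hn], (Hper x) as [m Hm]; rewrite Hn, Hm in *.
  assert (n = m); [|subst; ring].
  assert (-1 < IZR (m - n) < 1) by (rewrite minus_IZR; nra).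
  assert ((-1 < m - n < 1)%Z) by (split; apply lt_IZR; apply H).
  lia. }
assert (D0 : is_derive g z 0).
{ apply (is_derive_ext_loc (fun _ => g z)); [exact L|].
  exact (is_derive_const (K := R_AbsRing) (V := R_NormedModule) (g z) z). }
apply is_derive_unique in D0; apply is_derive_unique in Dg; lra.
Qed.

(** Differentiate the wave equation once more. That [U''] is differentiable follows from its
    expression through [sin (U x)]. *)
Lemma standing_wave_derive_hill (c : R) (U : R -> R) (T : R) :
  c ^ 2 <> 1 -> standing_wave c U T -> hill_solution c U 0 (Derive U).
Proof.
intros hc [HU _] z.
assert (E : forall x, Derive (Derive U) x = - sin (U x) / (c ^ 2 - 1)).
{ intros x; destruct (HU x) as [_ [_ h]].
  change (Derive (Derive U) x) with (Derive_n U 2 x).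
  apply (Rmult_eq_reg_l (c ^ 2 - 1)); [|lra]; field_simplify; lra. }
destruct (HU z) as [d1 [d2 _]].
assert (D : is_derive (Derive (Derive U)) z (- (cos (U z) * Derive U z) / (c ^ 2 - 1))).
{ apply (is_derive_ext (fun x => - sin (U x) / (c ^ 2 - 1))); [intros x; auto|].
  auto_derive; [auto|]; change (fun x => U x) with U; field; lra. }
split; [exact d2|]; split; [eexists; exact D|].
change (Derive_n (Derive U) 2 z) with (Derive (Derive (Derive U)) z).
rewrite (is_derive_unique _ _ _ D); field; lra.
Qed.

Lemma periodic_zero (V : R -> R) (T : R) :
  0 < T -> (forall z, V (z + T) = V z) ->
  (forall z, 0 <= z <= T -> V z = 0) -> forall z, V z = 0.
Proof.
intros HT HP H0 z.
assert (Hn : forall (n : nat) x, V (x + INR n * T) = V x).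
{ induction n as [|n IH]; intros x.
  - f_equal; simpl; ring.
  - rewrite S_INR; replace (x + (INR n + 1) * T) with (x + INR n * T + T) by ring.
    rewrite HP; apply IH. }
assert (Hpos : forall x, 0 <= x -> V x = 0).
{ intros x Hx.
  destruct (nfloor_ex (x / T)) as [n Hx'].
  - apply Rdiv_le_0_compat; lra.
  - replace x with ((x - INR n * T) + INR n * T) by ring.
    rewrite Hn; apply H0.
    destruct Hx' as [h1 h2].
    apply Rle_div_r in h1; [|lra]; apply Rlt_div_l in h2; [|lra]; lra. }
destruct (nfloor_ex (Rabs z / T)) as [n [_ h2]].
- apply Rdiv_le_0_compat; [apply Rabs_pos | lra].
- rewrite <- (Hn (S n)); apply Hpos.
  rewrite S_INR; apply Rlt_div_l in h2; [|lra].
  pose proof (Rle_abs (- z)); rewrite Rabs_Ropp in *; lra.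
Qed.

Lemma basis_of_fundamental (c : R) (U : R -> R) (T zeta : R) (q1 q2 : R -> R -> R) :
  hill_fundamental c U q1 q2 ->
  hill_basis (potential c U) (spectral c zeta) T
    (fun z => q1 z zeta) (Derive (fun z => q1 z zeta))
    (fun z => q2 z zeta) (Derive (fun z => q2 z zeta)).
Proof.
intros H; destruct (H zeta) as [h1 [h2 [h3 [h4 [h5 h6]]]]].
exact (conj (hill_solution_on c U T zeta _ h1) (conj (hill_solution_on c U T zeta _ h4)
  (conj h2 (conj h3 (conj h5 h6))))).
Qed.

(* [Derive U] is a [T]-periodic solution at spectral parameter [0]. *)
Lemma standing_wave_discriminant (c : R) (U : R -> R) (T : R) (y1 y1' y2 y2' : R -> R) :
  c ^ 2 <> 1 -> standing_wave c U T ->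
  hill_basis (potential c U) (spectral c 0) T y1 y1' y2 y2' ->
  y1 T + y2' T = 2.
Proof.
intros hc HU Hy; pose proof HU as [Hder [[z1 [z2 Hz]] [HT _]]].
destruct (bloch_discriminant _ _ T y1 y1' y2 y2' HT Hy) as [K HK].
pose proof (standing_wave_derive_hill c U T hc HU) as HV.
assert (PV : forall z, Derive U (z + T) = Derive U z)
  by (intros z; apply (standing_wave_derive_periodic c U T z HU)).
(* The wave equation expresses [U''] through [sin U], which does not see shifts of [U] by multiples
   of [2 * PI]. *)
assert (PV' : Derive (Derive U) T = Derive (Derive U) 0).
{ destruct (Hder T) as [_ [_ e1]], (Hder 0) as [_ [_ e2]].
  change (Derive_n U 2 T) with (Derive (Derive U) T) in e1.
  change (Derive_n U 2 0) with (Derive (Derive U) 0) in e2.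
  destruct HU as [_ [_ [_ [Hp _]]]]; destruct (Hp 0) as [n Hn].
  rewrite Rplus_0_l in Hn; rewrite Hn in e1.
  replace (sin (U 0 + 2 * PI * IZR n)) with (sin (U 0)) in e1.
  - apply (Rmult_eq_reg_l (c ^ 2 - 1)); lra.
  - rewrite sin_plus.
    replace (2 * PI * IZR n) with (2 * (IZR n * PI)) by ring.
    rewrite sin_2a, cos_2a_sin.
    replace (sin (IZR n * PI)) with 0 by (symmetry; apply sin_eq_0_1; exists n; ring).
    ring. }
(* With [lam = lam0] and [phi = 0] the error term vanishes, and the trace is exactly [2 * cos 0]. *)
specialize (HK (spectral c 0) 0 (fun z => (Derive U z, 0)) (fun z => (Derive (Derive U) z, 0))).
replace (spectral c 0 - spectral c 0) with 0 in HK by ring.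
rewrite cos_0, Rabs_R0 in HK.
assert (B : Rabs (2 * 1 - (y1 T + y2' T) - 0 * discriminant_slope T y1 y1' y2 y2') <= K * 0 ^ 2).
{ apply HK; [|lra].
  split; [exact (hill_solution_on c U T 0 _ HV)|]; split; [|split; [|split]].
  - split; intros z; [split; apply continuous_const|].
    intros _; simpl; rewrite Rmult_0_r.
    split; exact (is_derive_const (K := R_AbsRing) (V := R_NormedModule) 0 z).
  - rewrite <- (PV 0), Rplus_0_l, Ropp_0; unfold exp_i, Cmult; simpl.
    rewrite cos_0, sin_0; f_equal; ring.
  - rewrite PV', Ropp_0; unfold exp_i, Cmult; simpl.
    rewrite cos_0, sin_0; f_equal; ring.
  - apply NNPP; intros Hno.
    assert (Z : forall z, Derive U z = 0).
    { apply (periodic_zero _ T HT PV); intros z hz; apply NNPP; intros Hn.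
      apply Hno; exists z; split; [exact hz|]; intros E; apply Hn.
      now injection E. }
    assert (Cst : forall a b, a < b -> U a = U b).
    { intros a b Hab; apply (eq_is_derive U a b); [|exact Hab].
      intros t _; change (is_derive U t 0); rewrite <- (Z t); apply Derive_correct, Hder. }
    destruct (Rtotal_order z1 z2) as [h|[h|h]].
    + apply Hz, Cst, h.
    + apply Hz; now rewrite h.
    + apply Hz; symmetry; apply Cst, h. }
replace (K * 0 ^ 2) with 0 in B by ring.
apply Rabs_le_between in B; lra.
Qed.

(** * Slopes of the eigenvalue branch and of the Hill discriminant *)

Lemma is_derive_spectral (c zeta : R) :
  c ^ 2 <> 1 -> is_derive (spectral c) zeta (2 * zeta / (c ^ 2 - 1) ^ 2).
Proof.
intros hc; unfold spectral; auto_derive; [auto|]; field; lra.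
Qed.

Lemma locally_small (f : R -> R) (x0 : R) :
  ex_derive f x0 -> f x0 = 0 -> locally x0 (fun x => Rabs (f x) <= 1).
Proof.
intros Hf H0.
pose proof (proj1 (filterlim_locally _ _) (ex_derive_continuous f x0 Hf)
  (mkposreal 1 Rlt_0_1)) as N.
revert N; apply filter_imp; intros x Hx.
rewrite H0 in Hx; apply Rabs_lt_between' in Hx; simpl in Hx.
apply Rabs_le_between; lra.
Qed.

(* Implicit differentiation of
   [Delta (spectral zeta - mu zeta) = 2 cos (bloch_phase zeta)]. *)
Lemma branch_slope (c : R) (U : R -> R) (T theta zeta0 m : R) (mu : R -> R)
    (y1 y1' y2 y2' : R -> R) :
  c ^ 2 <> 1 -> 0 < T ->
  hill_basis (potential c U) (spectral c zeta0) T y1 y1' y2 y2' ->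
  eigenvalue_branch c U T theta zeta0 mu -> mu zeta0 = 0 -> is_derive mu zeta0 m ->
  (2 * zeta0 / (c ^ 2 - 1) ^ 2 - m) * discriminant_slope T y1 y1' y2 y2'
  = - 2 * (c * T / (c ^ 2 - 1)) * sin (bloch_phase c T theta zeta0).
Proof.
intros hc HT Hy [u [_ [_ Hu]]] H0 Hm.
destruct (bloch_discriminant _ _ T y1 y1' y2 y2' HT Hy) as [K HK].
set (delta := fun zeta => spectral c zeta - mu zeta - spectral c zeta0).
pose proof (is_derive_spectral c zeta0 hc) as Hs.
assert (Hd : is_derive delta zeta0 (2 * zeta0 / (c ^ 2 - 1) ^ 2 - m)).
{ unfold delta; auto_derive.
  - repeat split; eexists; eassumption.
  - derive_with Hs; derive_with Hm; ring. }
assert (Hd0 : delta zeta0 = 0) by (unfold delta; rewrite H0; ring).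
assert (Hf : is_derive (fun zeta => 2 * cos (bloch_phase c T theta zeta)) zeta0
  ((2 * zeta0 / (c ^ 2 - 1) ^ 2 - m) * discriminant_slope T y1 y1' y2 y2')).
(* The derivative of [2 * cos (bloch_phase c T theta zeta)] is computed twice: here from the
   discriminant expansion, below explicitly. *)
{ apply (is_derive_quadratic_error _ delta zeta0 (y1 T + y2' T) _ _ K Hd Hd0).
  generalize (filter_and _ _ Hu (locally_small delta zeta0 (ex_intro _ _ Hd) Hd0)).
  apply filter_imp; intros zeta [[hq [hn hL]] hs].
  destruct (eigenfunction_bloch c U T theta zeta (mu zeta) (u zeta) hc HT hq hn hL)
    as [w [w' Hw]].
  exact (HK _ _ _ _ Hw hs). }
apply is_derive_unique in Hf; rewrite <- Hf.
apply is_derive_unique; unfold bloch_phase; auto_derive; [auto|].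
change (c * zeta0 * T * / (c * (c * 1) - 1) + theta)
  with (c * zeta0 * T / (c ^ 2 - 1) + theta).
field; lra.
Qed.

Lemma D_Hill_eq (q1 q2 : R -> R -> R) (T zeta : R) :
  D_Hill q1 q2 T zeta = q1 T zeta + Derive (fun z => q2 z zeta) T - 2.
Proof.
unfold D_Hill, trace, H_matrix.
rewrite sum_Sn_m, sum_n_n by lia.
rewrite !coeff_mat_bij by lia; reflexivity.
Qed.

(** [hill_fundamental] fixes [q1] and [q2] separately for each [zeta]; differentiability in [zeta]
    is drawn from the perturbation estimate, applied to both solutions, and the chain rule through
    [spectral]. *)
Lemma is_derive_D_Hill (c : R) (U : R -> R) (T zeta0 : R) (q1 q2 : R -> R -> R) :
  c ^ 2 <> 1 -> 0 < T -> hill_fundamental c U q1 q2 ->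
  is_derive (D_Hill q1 q2 T) zeta0
    (2 * zeta0 / (c ^ 2 - 1) ^ 2 *
     discriminant_slope T (fun z => q1 z zeta0) (Derive (fun z => q1 z zeta0))
       (fun z => q2 z zeta0) (Derive (fun z => q2 z zeta0))).
Proof.
intros hc HT Hq.
pose proof (basis_of_fundamental c U T zeta0 q1 q2 Hq) as Hy.
destruct (solution_perturbation _ _ T _ _ _ _ HT Hy) as [K [K0 HK]].
set (y1 := fun z => q1 z zeta0) in *; set (y2 := fun z => q2 z zeta0) in *.
set (delta := fun zeta => spectral c zeta - spectral c zeta0).
pose proof (is_derive_spectral c zeta0 hc) as Hs.
assert (Hd : is_derive delta zeta0 (2 * zeta0 / (c ^ 2 - 1) ^ 2)).
{ unfold delta; auto_derive.
  - eexists; eassumption.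
  - derive_with Hs; ring. }
assert (Hd0 : delta zeta0 = 0) by (unfold delta; ring).
apply (is_derive_quadratic_error _ delta zeta0 (y1 T + Derive y2 T - 2) _ _
  (K * (Rabs (y1 T) + Rabs (y2 T) + Rabs (Derive y1 T) + Rabs (Derive y2 T))) Hd Hd0).
generalize (locally_small delta zeta0 (ex_intro _ _ Hd) Hd0).
apply filter_imp; intros zeta hs.
rewrite D_Hill_eq.
destruct (basis_of_fundamental c U T zeta q1 q2 Hq) as [S1 [S2 [i1 [i1' [i2 i2']]]]].
destruct (HK _ _ _ S1 hs) as [_ [A1 [A2 [e1 [_ [f1 f2]]]]]].
destruct (HK _ _ _ S2 hs) as [_ [B1 [B2 [_ [e2 [g1 g2]]]]]].
rewrite i1, i1', Rabs_R0, Rabs_R1 in f1, f2.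
rewrite i2, i2', Rabs_R0, Rabs_R1 in g1, g2.
rewrite e1, e2; unfold discriminant_slope.
change (q1 T zeta0) with (y1 T); change (q2 T zeta0) with (y2 T).
fold (delta zeta) in f1, f2, g1, g2.
set (d := delta zeta) in *.
match type of f1 with Rabs ?r <= _ => set (r1 := r) in * end.
match type of f2 with Rabs ?r <= _ => set (r2 := r) in * end.
match type of g1 with Rabs ?r <= _ => set (s1 := r) in * end.
match type of g2 with Rabs ?r <= _ => set (s2 := r) in * end.
match goal with |- Rabs ?x <= _ =>
  replace x with (r1 * y1 T + r2 * y2 T + (s1 * Derive y1 T + s2 * Derive y2 T))
    by (unfold r1, r2, s1, s2; ring) end.
apply Rle_trans with (1 := Rabs_triang _ _).
pose proof (Rabs_triang (r1 * y1 T) (r2 * y2 T)) as t1.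
pose proof (Rabs_triang (s1 * Derive y1 T) (s2 * Derive y2 T)) as t2.
rewrite !Rabs_mult in t1, t2.
pose proof (Rmult_le_compat_r _ _ _ (Rabs_pos (y1 T)) f1).
pose proof (Rmult_le_compat_r _ _ _ (Rabs_pos (y2 T)) f2).
pose proof (Rmult_le_compat_r _ _ _ (Rabs_pos (Derive y1 T)) g1).
pose proof (Rmult_le_compat_r _ _ _ (Rabs_pos (Derive y2 T)) g2).
lra.
Qed.

(* If the slope vanished, the monodromy matrix would be scalar and every solution
   of Hill's equation would give an element of the kernel. *)
Lemma discriminant_slope_nonzero (c : R) (U : R -> R) (T theta zeta0 : R)
    (q1 q2 : R -> R -> R) :
  c ^ 2 <> 1 -> standing_wave c U T -> hill_fundamental c U q1 q2 ->
  geometric_multiplicity c U T theta (RtoC zeta0) 1 ->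
  q1 T zeta0 + Derive (fun z => q2 z zeta0) T = 2 * cos (bloch_phase c T theta zeta0) ->
  discriminant_slope T (fun z => q1 z zeta0) (Derive (fun z => q1 z zeta0))
    (fun z => q2 z zeta0) (Derive (fun z => q2 z zeta0)) <> 0.
Proof.
intros hc [HU [_ [HT _]]] Hq [p [_ [_ Hp]]] Htr Hs.
pose proof (basis_of_fundamental c U T zeta0 q1 q2 Hq) as Hy.
pose proof (wronskian_basis _ _ _ _ _ _ _ T Hy ltac:(lra)) as W.
pose proof (COS_bound (bloch_phase c T theta zeta0)) as Cb.
destruct (discriminant_slope_zero _ _ _ _ _ _ _ HT Hy) as [z2 [z1 z3]];
  [cbv beta; rewrite Htr; nra | exact Hs |].
destruct (basis_snd_nonzero _ _ _ _ _ _ _ HT Hy) as [x [Hx Hn]].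
destruct (Hq zeta0) as [S1 [i1 [i1' [S2 [i2 i2']]]]].
cbv beta in *.
rewrite z3 in Htr, W.
set (m := q1 T zeta0) in *.
(* A scalar monodromy matrix of determinant [1] has [m^2 = 1]. Since [m] is the cosine of the phase,
   the sine vanishes and [m] is the multiplier itself. *)
assert (Hm : exp_i (- bloch_phase c T theta zeta0) = RtoC m).
{ unfold exp_i, RtoC; rewrite cos_neg, sin_neg; f_equal; [lra|].
  pose proof (sin2_cos2 (bloch_phase c T theta zeta0)) as h; unfold Rsqr in h.
  assert (hh : sin (bloch_phase c T theta zeta0) * sin (bloch_phase c T theta zeta0) = 0).
  { rewrite z1 in W; replace (cos (bloch_phase c T theta zeta0)) with m in h by lra; lra. }
  apply Rsqr_0_uniq in hh; rewrite hh; ring. }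
assert (CU : forall z, continuous U z) by (intros z; apply (ex_derive_continuous U), HU).
destruct (hill_solution_in_kernel c U T theta zeta0 m _ hc HT CU S1 Hm) as [p1 [k1 v1]];
  [fold m; rewrite i1; ring | rewrite z1, i1'; ring |].
destruct (hill_solution_in_kernel c U T theta zeta0 m _ hc HT CU S2 Hm) as [p2 [k2 v2]];
  [rewrite z2, i2; ring | rewrite z3, i2'; ring |].
destruct (Hp p1 k1) as [a Ha], (Hp p2 k2) as [b Hb].
unfold lin_comb in Ha, Hb.
assert (o0 : on_interval T 0) by (unfold on_interval; lra).
assert (ox : on_interval T x) by (unfold on_interval; lra).
pose proof (Ha 0 o0) as Ha0; pose proof (Hb 0 o0) as Hb0; pose proof (Hb x ox) as Hbx.
rewrite sum_n_n in Ha0, Hb0, Hbx.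
rewrite v1, i1 in Ha0; rewrite v2, i2 in Hb0; rewrite v2 in Hbx.
assert (Ne : forall t, exp_i t <> RtoC 0).
{ intros t E; apply (f_equal Cmod) in E; rewrite Cmod_exp_i, Cmod_R, Rabs_R0 in E; lra. }
(* The kernel element built from [q1] is nonzero at [0], hence so is the generator [p 1]. The one
   built from [q2] vanishes at [0], so its coefficient is [0], although it is nonzero at [x]. *)
assert (P0 : p 1%nat 0 <> RtoC 0).
{ intros E; rewrite E, Cmult_0_r, Cmult_1_r in Ha0; exact (Ne _ Ha0). }
assert (B0 : b 1%nat = RtoC 0).
{ apply NNPP; intros Hb1; rewrite Cmult_0_r in Hb0.
  exact (Cmult_neq_0 _ _ Hb1 P0 (eq_sym Hb0)). }
rewrite B0, Cmult_0_l in Hbx.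
refine (Cmult_neq_0 _ _ (Ne _) _ Hbx).
intros E; apply Hn; now injection E.
Qed.

(** Orders of vanishing that add up to [1] include one equal to [1]. *)
Lemma simple_branch (c : R) (U : R -> R) (T theta zeta0 : R) :
  algebraic_multiplicity c U T theta zeta0 1 ->
  exists mu, eigenvalue_branch c U T theta zeta0 mu /\ mu zeta0 = 0 /\
    Derive mu zeta0 <> 0.
Proof.
intros [k [mu [u [ord [_ [H [_ Hs]]]]]]].
assert (E : exists j, In j (seq 1 k) /\ ord j = 1%nat).
{ clear H; induction (seq 1 k) as [|j l IH]; simpl in Hs; [discriminate|].
  destruct (ord j) as [|[|n]] eqn:Ho; [| |lia].
  - destruct (IH Hs) as [i [Hi1 Hi2]]; exists i; simpl; auto.
  - exists j; simpl; auto. }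
destruct E as [j [Hj Ho]]; apply in_seq in Hj.
destruct (H j) as [h1 [h2 [_ h3]]]; [lia|].
exists (mu j); split; [exists (u j); exact h1|]; split; [exact h2|].
rewrite Ho in h3; exact h3.
Qed.

Theorem mainTheorem2
  (c : R) (hc : c ^ 2 <> 1)
  (U : R -> R) (T : R) (hU : standing_wave c U T)
  (theta : R) (htheta : 0 <= theta < 2 * PI)
  (zeta0 : R) (hsimple : simple_characteristic_value c U T theta zeta0)
  (mu : R -> R) (hmu : eigenvalue_branch c U T theta zeta0 mu)
  (hmu0 : mu zeta0 = 0)
  (q1 q2 : R -> R -> R) (hq : hill_fundamental c U q1 q2) :
  zeta0 <> 0 /\
  exists dD : R,
    is_derive (D_Hill q1 q2 T) zeta0 dD /\
    dD <> 0 /\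
    is_derive mu zeta0
      (2 * zeta0 / (c ^ 2 - 1) ^ 2
       + 4 * c * zeta0 * T / (c ^ 2 - 1) ^ 3
         * (sin (c * zeta0 * T / (c ^ 2 - 1) + theta) / dD)) /\
    krein_signature mu zeta0 =
      sign (2 * zeta0 / (c ^ 2 - 1) ^ 2
            + 4 * c * zeta0 * T / (c ^ 2 - 1) ^ 3
              * (sin (c * zeta0 * T / (c ^ 2 - 1) + theta) / dD)).
Proof.
pose proof hU as [_ [_ [HT _]]].
destruct hsimple as [[p0 [[k1 k2] k3]] [Hgeo Halg]].
pose proof (basis_of_fundamental c U T zeta0 q1 q2 hq) as Hy.
assert (a0 : c ^ 2 - 1 <> 0) by lra.
(* A kernel element is an eigenfunction with eigenvalue [0], so the expansion is used at
   [lam = lam0], where it is exact. *)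
assert (Htr : q1 T zeta0 + Derive (fun z => q2 z zeta0) T
  = 2 * cos (bloch_phase c T theta zeta0)).
{ destruct (bloch_discriminant _ _ T _ _ _ _ HT Hy) as [K HK].
  destruct (eigenfunction_bloch c U T theta zeta0 0 p0 hc HT k1 k3) as [w [w' Hw]].
  { intros z hz; rewrite k2 by exact hz; ring. }
  specialize (HK _ _ _ _ Hw).
  replace (spectral c zeta0 - 0 - spectral c zeta0) with 0 in HK by ring.
  rewrite Rabs_R0 in HK; specialize (HK ltac:(lra)).
  replace (K * 0 ^ 2) with 0 in HK by ring.
  apply Rabs_le_between in HK; lra. }
pose proof (discriminant_slope_nonzero c U T theta zeta0 q1 q2 hc hU hq Hgeo Htr) as HD.
set (D := discriminant_slope T (fun z => q1 z zeta0) (Derive (fun z => q1 z zeta0))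
    (fun z => q2 z zeta0) (Derive (fun z => q2 z zeta0))) in *.
(* At [zeta0 = 0] the trace is [2], so the sine of the phase vanishes. Then [branch_slope] leaves
   [Derive nu 0 * D = 0] for a branch [nu] of order one, while [D] is nonzero. *)
assert (Z0 : zeta0 <> 0).
{ intros E.
  destruct (simple_branch _ _ _ _ _ Halg) as [nu [b1 [b2 b3]]].
  pose proof b1 as [u [Han _]].
  pose proof (branch_slope c U T theta zeta0 (Derive nu zeta0) nu _ _ _ _ hc HT Hy b1 b2
    (Derive_correct _ _ (analytic_at_derivable _ _ Han))) as Hb.
  fold D in Hb.
  assert (H2 : q1 T zeta0 + Derive (fun z => q2 z zeta0) T = 2).
  { rewrite E in Hy; pose proof (standing_wave_discriminant c U T _ _ _ _ hc hU Hy) as h.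
    cbv beta in h; rewrite E; exact h. }
  assert (Hs : sin (bloch_phase c T theta zeta0) = 0).
  { apply Rsqr_0_uniq; pose proof (sin2_cos2 (bloch_phase c T theta zeta0)) as h.
    replace (cos (bloch_phase c T theta zeta0)) with 1 in h by lra.
    unfold Rsqr in *; lra. }
  rewrite Hs, E in Hb.
  apply b3, (Rmult_eq_reg_r D); [|exact HD].
  unfold Rdiv in Hb; rewrite E; lra. }
split; [exact Z0|].
pose proof hmu as [u [Han _]].
pose proof (branch_slope c U T theta zeta0 (Derive mu zeta0) mu _ _ _ _ hc HT Hy hmu hmu0
    (Derive_correct _ _ (analytic_at_derivable _ _ Han))) as Hb.
fold D in Hb.
exists (2 * zeta0 / (c ^ 2 - 1) ^ 2 * D).
assert (Hmu : Derive mu zeta0 = 2 * zeta0 / (c ^ 2 - 1) ^ 2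
       + 4 * c * zeta0 * T / (c ^ 2 - 1) ^ 3
         * (sin (c * zeta0 * T / (c ^ 2 - 1) + theta) / (2 * zeta0 / (c ^ 2 - 1) ^ 2 * D))).
(* [branch_slope] gives the product of [D] with the slope; the factor [2 * zeta0 / (c ^ 2 - 1) ^ 2]
   between [D] and the derivative of [D_Hill] accounts for the coefficient of the sine. *)
{ apply (Rmult_eq_reg_r D); [|exact HD].
  replace (Derive mu zeta0 * D) with (2 * zeta0 / (c ^ 2 - 1) ^ 2 * D
    - (2 * zeta0 / (c ^ 2 - 1) ^ 2 - Derive mu zeta0) * D) by ring.
  rewrite Hb; unfold bloch_phase; field; auto. }
split; [apply (is_derive_D_Hill c U T zeta0 q1 q2 hc HT hq)|].
split; [|split].
- apply Rmult_integral_contrapositive_currified; [|exact HD].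
  apply Rmult_integral_contrapositive_currified; [lra|].
  apply Rinv_neq_0_compat, pow_nonzero, a0.
- rewrite <- Hmu; apply Derive_correct, (analytic_at_derivable _ _ Han).
- unfold krein_signature; rewrite Hmu; reflexivity.
Qed.
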